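(* Let $m>1$ be an odd integer. Let $X$ be a centered Gaussian process with canonical metric $\delta^2(s,t):=\mathbf{E}\left[(X(t)-X(s))^2\right]$. Define a univariate function, also denoted by $\delta^2$, via $$\delta^2(r):=\sup_{s\in[0,T]}\delta^2(s,s+r),$$ and assume that $\delta(r)=o\left(r^{1/(2m)}\right)$ for $r$ near $0$. Assume that, in the sense of distributions, the mixed second derivative $\partial^2\delta^2/(\partial s\,\partial t)$ of the bivariate function $\delta^2$ is a signed $\sigma$-finite measure $\mu$ on the complement of the diagonal $\Delta=\{(s,s)\}$ in the square. For $\varepsilon>0$ denote the off-diagonal simplex by $$OD=OD_\varepsilon=\{(s,t):0\le s\le t-\varepsilon\le T\},$$ and assume that for some constant $c$ and for all $\varepsilon>0$ small enough, $$|\mu|(OD_\varepsilon)\le c\,\varepsilon^{-(m-1)/m},$$ where $|\mu|$ is the total variation measure of $\mu$. Then $X$ has zero $m$-th variation on $[0,T]$.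
   Context: Fix $T>0$, $\varepsilon_0>0$ and put $T_*=T+\varepsilon_0$. The process $X$ is indexed by $[0,T_*]$, so that $X(s+\varepsilon)$ makes sense for $s\in[0,T]$ and $0<\varepsilon\le\varepsilon_0$; the bivariate $\delta^2$ is defined on $[0,T_*]^2$, the univariate $\delta^2(r)$ on $0\le r\le\varepsilon_0$ (with $\delta\ge0$), and $\mu$ lives on $[0,T_*]^2\setminus\Delta$. It is a standing assumption that the centered Gaussian process $X$ is represented as $X(t)=\int_0^{T_*}G(t,s)\,dW(s)$, where $W$ is a standard Brownian motion and $G$ is a non-random measurable function on $[0,T_*]^2$ with $G(t,\cdot)$ square-integrable for every $t$. For an odd integer $m$ set $$[X,m]_\varepsilon(T):=\frac1\varepsilon\int_0^T\left(X(s+\varepsilon)-X(s)\right)^m ds .$$ $X$ has zero ($=$ zero odd) $m$-th variation on $[0,T]$ if $\lim_{\varepsilon\to0^+}[X,m]_\varepsilon(T)=0$ in $L^2(\Omega)$. *)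

(* Defs.v *)
From HB Require Import structures.
From mathcomp Require Import all_boot all_order all_algebra.
From mathcomp Require Import all_classical all_reals all_analysis.
Set Implicit Arguments.
Unset Strict Implicit.
Unset Printing Implicit Defensive.
Import Order.TTheory GRing.Theory Num.Theory.
Import numFieldNormedType.Exports.
Local Open Scope classical_set_scope.
Local Open Scope ring_scope.

(* A process indexed by [0, Tmax] is a family [R -> {RV P >-> R}] of which only
   the times in [0, Tmax] are ever used. *)

Section processes.
Context {d : measure_display} {Omega : measurableType d} {R : realType}.
Variable P : probability Omega R.

Definition mutually_independent n (Y : 'I_n -> Omega -> R) : Prop :=
  forall B : 'I_n -> set R, (forall i, measurable (B i)) ->
    P (\bigcap_(i in [set: 'I_n]) (Y i @^-1` B i)) =
    (\prod_(i < n) P (Y i @^-1` B i))%E.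

(* Constants count as Gaussian; the case [s = 0] is separated because
   [normal_prob m 0] is not the Dirac mass at [m]. *)
Definition gaussian (Y : Omega -> R) : Prop :=
  exists m s : R, 0 <= s /\ forall A : set R, measurable A ->
    P (Y @^-1` A) = if s == 0 then \d_m A else normal_prob m s A.

Definition centered_gaussian_process (Tmax : R) (X : R -> {RV P >-> R}) : Prop :=
  (forall t, t \in `[0, Tmax] -> 'E_P[X t]%E = 0%E) /\
  (forall n (t a : 'I_n -> R), (forall i, t i \in `[0, Tmax]) ->
    gaussian (fun w => \sum_(i < n) a i * X (t i) w)).

Definition measurable_process (Tmax : R) (X : R -> {RV P >-> R}) : Prop :=
  measurable_fun (`[0, Tmax] `*` [set: Omega])
    (fun p : R * Omega => X p.1 p.2).

Definition standard_brownian_motion (Tmax : R) (W : R -> {RV P >-> R}) : Prop :=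
  [/\ {ae P, forall w, W 0 w = 0},
      (forall n (t : nat -> R), (forall i, (i <= n)%N -> t i \in `[0, Tmax]) ->
        (forall i, (i < n)%N -> t i <= t i.+1) ->
        mutually_independent (fun (i : 'I_n) w => W (t i.+1) w - W (t i) w)),
      (forall s t, 0 <= s -> s < t -> t <= Tmax ->
        forall A : set R, measurable A ->
        P ((fun w => W t w - W s w) @^-1` A) =
        normal_prob 0 (Num.sqrt (t - s)) A) &
      {ae P, forall w, {within `[0, Tmax], continuous (fun t => W t w)}}].

(* An entry [(a, (u, v))] of [g] stands for [a] times the indicator of ]u, v]. *)
Definition step_fun (g : seq (R * (R * R))) (s : R) : R :=
  \sum_(x <- g) x.1 * \1_(`]x.2.1, x.2.2]%classic) s.

Definition step_integral (W : R -> Omega -> R) (g : seq (R * (R * R)))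
    (w : Omega) : R :=
  \sum_(x <- g) x.1 * (W x.2.2 w - W x.2.1 w).

(* [Y] is (a version of) the Wiener integral of [g] over [0, Tmax] against [W]:
   the L^2 limit of the integrals of step functions converging to [g] in L^2. *)
Definition is_wiener_integral (Tmax : R) (W : R -> Omega -> R) (g : R -> R)
    (Y : Omega -> R) : Prop :=
  exists h : nat -> seq (R * (R * R)),
    [/\ (forall n x, x \in h n ->
           [/\ 0 <= x.2.1, x.2.1 <= x.2.2 & x.2.2 <= Tmax]),
        (\int[lebesgue_measure]_(s in `[0%R, Tmax])
           ((step_fun (h n) s - g s) ^+ 2)%:E)%E @[n --> \oo] --> 0%E &
        'E_P[(fun w => ((step_integral W (h n) w - Y w) ^+ 2)%R)]%E @[n --> \oo]
           --> 0%E].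

Definition wiener_kernel (Tmax : R) (G : R -> R -> R) : Prop :=
  measurable_fun (`[0, Tmax] `*` `[0, Tmax]) (fun p : R * R => G p.1 p.2) /\
  (forall t, t \in `[0, Tmax] ->
     lebesgue_measure.-integrable `[0, Tmax] (fun s => ((G t s) ^+ 2)%:E)).

(* Real-valued; nothing is lost through [fine] for the processes of interest,
   since the increments of a Gaussian process have finite variance. *)
Definition delta2 (X : R -> {RV P >-> R}) (s t : R) : R :=
  fine 'E_P[(fun w => ((X t w - X s w) ^+ 2)%R)]%E.

(* Kept in [\bar R] so that an infinite supremum is not sent to [0]. *)
Definition delta2_sup (X : R -> {RV P >-> R}) (T r : R) : \bar R :=
  ereal_sup [set (delta2 X s (s + r))%:E | s in `[0, T]].

Definition delta_sup (X : R -> {RV P >-> R}) (T r : R) : \bar R :=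
  (delta2_sup X T r `^ 2^-1)%E.

Definition odd_variation (X : R -> {RV P >-> R}) (T : R) (m : nat) (eps : R)
    (w : Omega) : R :=
  eps^-1 * (\int[lebesgue_measure]_(s in `[0, T]) (X (s + eps) w - X s w) ^+ m).

Definition zero_odd_variation (X : R -> {RV P >-> R}) (T : R) (m : nat) : Prop :=
  ('N[P]_(2%:E) [EFin \o odd_variation X T m eps])%E @[eps --> 0^'+] --> 0%E.

End processes.

(* A signed sigma-finite measure, given by its Jordan decomposition. Both parts
   may have infinite mass, so that the value [spos A - sneg A] is defined only
   on sets where one of them is finite; this is why it is not a [charge]. *)
Record signed_measure d (T : measurableType d) (R : realType) := SignedMeasure {
  spos : {sigma_finite_measure set T -> \bar R} ;
  sneg : {sigma_finite_measure set T -> \bar R} ;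
  spos_sneg_singular : exists N : set T,
    [/\ measurable N, spos N = 0%E & sneg (~` N) = 0%E] }.

Definition abs_measure d (T : measurableType d) (R : realType)
    (mu : signed_measure T R) (A : set T) : \bar R :=
  (spos mu A + sneg mu A)%E.

Section plane.
Context {R : realType}.

Definition time_square (Tmax : R) : set (R * R) := `[0, Tmax] `*` `[0, Tmax].

Definition open_square (Tmax : R) : set (R * R) := `]0, Tmax[ `*` `]0, Tmax[.

Definition partial1 (phi : R * R -> R) (p : R * R) : R :=
  derive1 (fun u => phi (u, p.2)) p.1.

Definition partial2 (phi : R * R -> R) (p : R * R) : R :=
  derive1 (fun u => phi (p.1, u)) p.2.

Fixpoint iter_partial (w : seq bool) (phi : R * R -> R) : R * R -> R :=
  if w is b :: w' then
    (if b then partial1 else partial2) (iter_partial w' phi)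
  else phi.

Definition smooth (phi : R * R -> R) : Prop :=
  forall w, let psi := iter_partial w phi in
    [/\ continuous psi,
        (forall p, derivable (fun u => psi (u, p.2)) p.1 1) &
        (forall p, derivable (fun u => psi (p.1, u)) p.2 1)].

Definition test_function (U : set (R * R)) (phi : R * R -> R) : Prop :=
  let supp := closure [set p | phi p != 0] in
  [/\ smooth phi, compact supp & supp `<=` U].

(* On the open set [U], the distribution [d^2 f / ds dt] is the signed measure
   [mu]. The integrability clauses say that [f] and [mu] both define
   distributions on [U], i.e. that the two pairings make sense. *)
Definition mixed_derivative_is (U : set (R * R)) (f : R -> R -> R)
    (mu : signed_measure (R * R)%type R) : Prop :=
  let leb2 := (@lebesgue_measure R \x @lebesgue_measure R)%E in
  forall phi, test_function U phi ->
    [/\ leb2.-integrable U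
          (fun p => (f p.1 p.2 * partial1 (partial2 phi) p)%:E),
        (spos mu).-integrable U (EFin \o phi),
        (sneg mu).-integrable U (EFin \o phi) &
        \int[leb2]_(p in U) (f p.1 p.2 * partial1 (partial2 phi) p) =
        \int[spos mu]_(p in U) phi p - \int[sneg mu]_(p in U) phi p].

Definition OD (T eps : R) : set (R * R) :=
  [set p | [/\ 0 <= p.1, p.1 <= p.2 - eps & p.2 - eps <= T]].

End plane.

(* Main.v *)
Require Import Defs.
From HB Require Import structures.
From mathcomp Require Import all_boot all_order all_algebra.
From mathcomp Require Import all_classical all_reals all_analysis.
From mathcomp Require Import measurable_realfun.
From mathcomp Require Import ring lra.
Set Implicit Arguments.
Unset Strict Implicit.
Unset Printing Implicit Defensive.
Import Order.TTheory GRing.Theory Num.Theory.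
Import numFieldNormedType.Exports.
Local Open Scope classical_set_scope.
Local Open Scope ring_scope.

(** Write [D X_s] for the increment of [X] over [s, s + e] and [th s t] for the
    covariance of [D X_s] and [D X_t].  The square of the L^2 norm of the odd
    variation is [e^-2] times the double integral over [0, T]^2 of the
    expectation of [(D X_s)^m (D X_t)^m] ([second_moment_integral_le]).

    As [m] is odd, that mixed moment of a Gaussian pair vanishes with the
    covariance: it is at most a constant times [V^(m-1) |th s t|], where [V]
    bounds the variances ([gaussian_odd_moment_le]).  The even moments of the
    centered Gaussian variable [a U + b V] are multiples of powers of its
    variance, which is a quadratic form in [(a, b)]; comparing the coefficients
    of [a^m b^m] expresses the mixed moment by the covariance, and the terms of
    degree 0 in the covariance drop out by parity.

    It remains to bound the integral of [|th|].  Where [s] and [t] are within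
    [4 e] of each other or within [e] of an endpoint, [|th| <= V], and this
    strip has area at most [12 T e].  Elsewhere [-2 th s t] is the increment of
    the bivariate [delta^2] over the rectangle [s, s + e] x [t, t + e], and is
    at most the mass that [|mu|] gives to a slightly larger rectangle
    ([rectangle_increment_le]); by Tonelli these masses integrate to at most
    [18 e^2 |mu|(OD_e)] ([integral_window_le]).

    With [V = eta^2 e^(1/m)], where [eta] is as small as one likes by the
    hypothesis on [delta], both contributions are bounded, after division by
    [e^2], by a constant times [eta^2] ([odd_variation_bound]).

    The rectangle estimate is the point where the distributional hypothesis is
    used.  It is tested against the product of two smooth plateau functions,
    whose mixed derivative is a combination of four mollifiers centered at the
    corners of the rectangle.  The pairing with [delta^2] tends to the
    rectangular increment because [X] is mean-square continuous on [0, T],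
    which is a consequence of the hypothesis on [delta]. *)

(** * Smooth functions of one variable *)

Section differentiability_classes.
Context {R : realType}.
Implicit Types f g : R -> R.

(** The derivative is part of the data, so that closure properties follow by
    induction on [n] from the rules of differential calculus. *)
Fixpoint diffn n f : Prop :=
  if n is n'.+1 then
    exists2 g : R -> R, (forall x : R, is_derive x 1 f (g x)) & diffn n' g
  else True.

Definition diffoo f : Prop := forall n, diffn n f.

Lemma diffnS n f : diffn n.+1 f -> diffn n f.
Proof.
elim: n f => [//|n IH] f [g fg dg]; exists g => //; exact: IH.
Qed.

Lemma diffn_cst n (c : R) : diffn n (fun=> c).
Proof.
elim: n c => [//|n IH] c; exists (fun=> 0) => // x.
exact: is_derive_cst.
Qed.

Lemma diffnD n f g : diffn n f -> diffn n g -> diffn n (fun x => f x + g x).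
Proof.
elim: n f g => [//|n IH] f g [f' ff' df'] [g' gg' dg'].
by exists (fun x => f' x + g' x); [move=> x; exact: is_deriveD|exact: IH].
Qed.

Lemma diffnM n f g : diffn n f -> diffn n g -> diffn n (fun x => f x * g x).
Proof.
elim: n f g => [//|n IH] f g df dg.
have [f' ff' df'] := df; have [g' gg' dg'] := dg.
exists (fun x => f x * g' x + g x * f' x).
  by move=> x; have := is_deriveM (ff' x) (gg' x).
by apply: diffnD; apply: IH => //; exact: diffnS.
Qed.

Lemma diffnZ n (c : R) f : diffn n f -> diffn n (fun x => c * f x).
Proof. by apply: diffnM; exact: diffn_cst. Qed.

Lemma is_derive_affine (a b x : R) :
  is_derive x 1 (fun y => a * y + b) a.
Proof.
have h1 := is_deriveD (is_deriveM (is_derive_cst a x 1) (is_derive_id x 1))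
  (is_derive_cst b x 1).
apply: is_derive_eq h1 _.
by rewrite scaler0 !addr0 /GRing.scale/= mulr1.
Qed.

Lemma diffn_affine n f (a b : R) :
  diffn n f -> diffn n (fun x => f (a * x + b)).
Proof.
elim: n f => [//|n IH] f [f' ff' df'].
exists (fun x => f' (a * x + b) * a).
  move=> x; exact: (@is_derive1_comp _ f (fun y => a * y + b) x _ _
    (ff' (a * x + b)) (is_derive_affine a b x)).
by apply: diffnM; [exact: IH|exact: diffn_cst].
Qed.

Lemma diffnV n f : (forall x, f x != 0) -> diffn n f ->
  diffn n (fun x => (f x)^-1).
Proof.
move=> f0; elim: n f f0 => [//|n IH] f f0 df.
have [f' ff' df'] := df.
exists (fun x => (-1) * f' x * ((f x)^-1 * (f x)^-1)).
  move=> x; apply: is_derive_eq (is_deriveV (f0 x) (ff' x)) _.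
  by rewrite /GRing.scale/=; field; exact: f0.
apply: diffnM; first exact: diffnZ.
by apply: diffnM; apply: IH => //; exact: diffnS.
Qed.

Lemma diffoo_derivable f x : diffoo f -> derivable f x 1.
Proof. by move=> /(_ 1%N)[g fg _]; have [] := fg x. Qed.

Lemma diffoo_derive1 f : diffoo f -> diffoo f^`()%classic.
Proof.
move=> df n; have [g fg dg] := df n.+1.
rewrite (_ : f^`()%classic = g)//.
by apply/funext => x; rewrite derive1E; have [_ ->] := fg x.
Qed.

Lemma diffoo_continuous f : diffoo f -> continuous f.
Proof.
move=> df x; apply: differentiable_continuous.
by apply/derivable1_diffP; exact: diffoo_derivable.
Qed.

End differentiability_classes.

(** * A smooth step *)

Section exp_inverse.
Context {R : realType}.

(** The functions [x^-k exp(-1/x)], extended by 0 to the half-line [x <= 0];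
    the span of these functions is stable under differentiation, which makes
    each of them smooth. *)
Definition expinv (k : nat) (x : R) : R :=
  if 0 < x then x^-1 ^+ k * expR (- x^-1) else 0.

Lemma expinv_ge0 k x : 0 <= expinv k x.
Proof.
rewrite /expinv; case: ifP => // x0.
by rewrite mulr_ge0 ?expR_ge0// exprn_ge0// invr_ge0 ltW.
Qed.

Lemma expinv_gt0 k x : 0 < x -> 0 < expinv k x.
Proof.
by rewrite /expinv => x0; rewrite x0 mulr_gt0 ?expR_gt0// exprn_gt0// invr_gt0.
Qed.

(** With [y = 1/x] this is [y^(k+1) <= (k+1)! exp y], a term of the exponential
    series; it gives the continuity at 0. *)
Lemma expinv_le k x : expinv k x <= (k.+1)`!%:R * `|x|.
Proof.
rewrite /expinv; case: ifP => x0; last by rewrite mulr_ge0.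
have y0 : 0 < x^-1 by rewrite invr_gt0.
rewrite gtr0_norm//.
have := expR_ge1Dxn k (ltW y0); set e := expR _ => he.
have e0 : 0 < e by exact: expR_gt0.
have f0 : 0 < (k.+1)`!%:R :> R by rewrite ltr0n fact_gt0.
rewrite expRN -/e ler_pdivrMr// mulrAC -ler_pdivrMr//.
have -> : x^-1 ^+ k / x = x^-1 ^+ k.+1 by rewrite exprSr.
rewrite mulrC -ler_pdivrMr//; apply: le_trans he; lra.
Qed.

Lemma expinv_continuous0 k : {for 0, continuous (expinv k)}.
Proof.
have e0 : expinv k 0 = 0 by rewrite /expinv ltxx.
apply/cvgrPdist_le => /= e e_gt0; rewrite e0.
have f0 : 0 < (k.+1)`!%:R :> R by rewrite ltr0n fact_gt0.
near=> x; rewrite sub0r normrN ger0_norm ?expinv_ge0//.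
apply: le_trans (expinv_le _ _) _.
rewrite mulrC -ler_pdivlMr//.
near: x; apply: filterS (nbhsx_ballx (0 : R) _ (divr_gt0 e_gt0 f0)).
move=> x; rewrite /ball/= sub0r normrN; exact: ltW.
Unshelve. all: by end_near. Qed.

Lemma is_derive_expinv (k : nat) (x : R) :
  is_derive x 1 (expinv k) (- k%:R * expinv k.+1 x + expinv k.+2 x).
Proof.
have [x0|x0|->] := ltgtP x 0.
- apply: (near_eq_is_derive (f := fun=> 0)).
    near=> z; rewrite /expinv ltNge ifN// negbK.
    near: z; apply: filterS (lt_nbhsl x0) => z; exact: ltW.
  rewrite /expinv ltNge (ltW x0)/= mulr0 add0r; exact: is_derive_cst.
- apply: (@near_eq_is_derive R R R (fun z => (z^-1) ^+ k * expR (- z^-1))).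
    near=> z; rewrite /expinv ifT//.
    by near: z; exact: lt_nbhsr.
  have xn0 : x != 0 by rewrite gt_eqF.
  have di : is_derive x 1 (fun z : R => z^-1) (- x ^- 2).
    apply: is_derive_eq (is_deriveV xn0 (is_derive_id x 1)) _.
    by rewrite /GRing.scale/= mulr1.
  have dN : is_derive x 1 (fun z : R => - z^-1) (x ^- 2).
    by apply: is_derive_eq (is_deriveN di) _; rewrite opprK.
  have dX : is_derive x 1 (fun z : R => z^-1 ^+ k) (- k%:R * x^-1 ^+ k.+1).
    case: k => [|k].
      by rewrite oppr0 mul0r; exact: is_derive_cst.
    have := is_deriveX k.+1 di; rewrite exprfctE => dX.
    apply: is_derive_eq dX _; rewrite /GRing.scale/= -[(_ *+ _)%R]mulr_natl !exprS; field; exact: xn0.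
  have dE := @is_derive1_comp _ expR (fun z => - z^-1) x _ _
    (is_derive_expR (- x^-1)) dN.
  have dM := is_deriveM dX dE.
  apply: is_derive_eq dM _; rewrite /expinv x0 /GRing.scale/= !exprS.
  by set u := expR _; field; exact: xn0.
(* at 0 the difference quotient is again a function of the family *)
- apply/is_derive1_caratheodory; exists (expinv k.+1); split.
  + move=> z; rewrite subr0 /expinv ltxx subr0; case: ifP => [z0|_].
      rewrite exprS; field; exact: lt0r_neq0.
    by rewrite mul0r.
  + exact: expinv_continuous0.
  + by rewrite /expinv ltxx mulr0 addr0.
Unshelve. all: by end_near. Qed.

Lemma diffoo_expinv k : diffoo (expinv k).
Proof.
move=> n; elim: n k => [//|n IH] k.
exists (fun x => - k%:R * expinv k.+1 x + expinv k.+2 x).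
  exact: is_derive_expinv.
by apply: diffnD => //; exact: diffnZ.
Qed.

End exp_inverse.
Section smooth_step.
Context {R : realType}.

Let den (x : R) := expinv 0 (x + 1) + expinv 0 (- x + 1).

(** The quotient of two smooth functions with positive denominator: it passes
    from 0 for [x <= -1] to 1 for [x >= 1]. *)
Definition step (x : R) : R := expinv 0 (x + 1) / den x.

Definition dstep (x : R) : R :=
  (expinv 2 (x + 1) * expinv 0 (- x + 1) +
   expinv 0 (x + 1) * expinv 2 (- x + 1)) / den x ^+ 2.

Let den_gt0 x : 0 < den x.
Proof.
rewrite /den; have [x1|x1] := ltP 0 (x + 1).
  by rewrite ltr_pwDl ?expinv_gt0// expinv_ge0.
by rewrite ltr_wpDl ?expinv_ge0// expinv_gt0//; lra.
Qed.

Lemma expinv_le0 k (x : R) : x <= 0 -> expinv k x = 0.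
Proof. by rewrite /expinv ltNge => ->. Qed.

Lemma step_le0 x : x <= -1 -> step x = 0.
Proof. by move=> x1; rewrite /step expinv_le0 ?mul0r//; lra. Qed.

Lemma step_ge1 x : 1 <= x -> step x = 1.
Proof.
move=> x1; have := den_gt0 x; rewrite /step /den [expinv 0 (- x + 1)]expinv_le0; last lra.
by rewrite addr0 => e0; rewrite divff// gt_eqF.
Qed.

Lemma step_ge0 x : 0 <= step x.
Proof. by rewrite divr_ge0 ?expinv_ge0// ltW. Qed.

Lemma step_le1 x : step x <= 1.
Proof. by rewrite ler_pdivrMr// mul1r lerDl expinv_ge0. Qed.

Lemma dstep_ge0 x : 0 <= dstep x.
Proof.
by rewrite divr_ge0 ?sqr_ge0// addr_ge0// mulr_ge0 ?expinv_ge0.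
Qed.

Lemma dstep_eq0 x : 1 <= `|x| -> dstep x = 0.
Proof.
rewrite /dstep ler_normr => /orP[|] x1.
  by rewrite ![expinv _ (- x + 1)]expinv_le0 ?mulr0 ?addr0 ?mul0r//; lra.
by rewrite ![expinv _ (x + 1)]expinv_le0 ?mul0r ?addr0 ?mul0r//; lra.
Qed.

Let is_derive_expinv0 (a x : R) :
  is_derive x 1 (fun y => expinv 0 (a * y + 1)) (expinv 2 (a * x + 1) * a).
Proof.
apply: (@is_derive1_comp _ (expinv 0) (fun y => a * y + 1) x _ _ _
  (is_derive_affine a 1 x)).
by apply: is_derive_eq (is_derive_expinv 0 _) _; rewrite oppr0 mul0r add0r.
Qed.

Lemma is_derive_step (x : R) : is_derive x 1 step (dstep x).
Proof.
have d1 := is_derive_expinv0 1 x; have d2 := is_derive_expinv0 (-1) x.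
have dn0 : den x != 0 by rewrite gt_eqF.
have eden : den = (fun y => expinv 0 (1 * y + 1)) + (fun y => expinv 0 (-1 * y + 1)).
  by apply/funext => y; rewrite /den fctE mulN1r mul1r.
have dd : is_derive x 1 den
    (expinv 2 (1 * x + 1) * 1 + expinv 2 (-1 * x + 1) * -1).
  by rewrite eden; exact: is_deriveD.
have dm := is_deriveM d1 (is_deriveV dn0 dd).
have -> : step = (fun y => expinv 0 (1 * y + 1)) * (fun y => (den y)^-1).
  by apply/funext => y; rewrite /step fctE mul1r.
apply: is_derive_eq dm _; rewrite /GRing.scale/= !mul1r !mulN1r !mulr1.
move: dn0; rewrite /dstep /den => dn0; field; exact: dn0.
Qed.

Lemma diffoo_step : diffoo step.
Proof.
move=> n; apply: diffnM.
  by have := diffn_affine 1 1 (@diffoo_expinv R 0 n); under eq_fun do rewrite mul1r.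
apply: diffnV; first by move=> x; rewrite gt_eqF.
apply: diffnD.
  by have := diffn_affine 1 1 (@diffoo_expinv R 0 n); under eq_fun do rewrite mul1r.
by have := diffn_affine (-1) 1 (@diffoo_expinv R 0 n); under eq_fun do rewrite mulN1r.
Qed.

Lemma step_derive1 : (step^`())%classic = dstep.
Proof.
by apply/funext => x; rewrite derive1E; have [_ ->] := is_derive_step x.
Qed.

Lemma dstep_continuous : continuous dstep.
Proof.
by rewrite -step_derive1; apply: diffoo_continuous; exact: diffoo_derive1 diffoo_step.
Qed.

End smooth_step.

Section mollifier.
Context {R : realType}.
Implicit Types h c x : R.

Definition rescaled_step h c x := step (h^-1 * x + - (h^-1 * c)).

(** The derivative of [rescaled_step h c]: a bump of mass 1 supported in
    [c - h, c + h]. *)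
Definition mollifier h c x := dstep (h^-1 * x + - (h^-1 * c)) * h^-1.

(** A smooth version of the indicator of [c1, c2], with transitions of width
    [2 h] at the ends; its derivative is a difference of mollifiers. *)
Definition plateau h c1 c2 x := rescaled_step h c1 x - rescaled_step h c2 x.

Lemma is_derive_rescaled_step h c x :
  is_derive x 1 (rescaled_step h c) (mollifier h c x).
Proof.
exact: (@is_derive1_comp _ step (fun y => h^-1 * y + - (h^-1 * c)) x _ _
  (is_derive_step _) (is_derive_affine _ _ x)).
Qed.

Lemma diffoo_plateau h c1 c2 : diffoo (plateau h c1 c2).
Proof.
move=> n; apply: diffnD; first exact/diffn_affine/diffoo_step.
have := diffnZ (-1) (diffn_affine h^-1 (- (h^-1 * c2)) (@diffoo_step R n)).
by under eq_fun do rewrite mulN1r.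
Qed.

Lemma plateau_derive1 h c1 c2 x :
  (plateau h c1 c2)^`()%classic x = mollifier h c1 x - mollifier h c2 x.
Proof.
rewrite derive1E.
by have [_ ->] := is_deriveB (is_derive_rescaled_step h c1 x)
  (is_derive_rescaled_step h c2 x).
Qed.

Lemma plateau_norm_le1 h c1 c2 x : `|plateau h c1 c2 x| <= 1.
Proof.
rewrite /plateau /rescaled_step.
move: (h^-1 * x + - (h^-1 * c1)) (h^-1 * x + - (h^-1 * c2)) => u v.
have := @step_ge0 R u; have := @step_le1 R u.
have := @step_ge0 R v; have := @step_le1 R v.
by move=> *; rewrite ler_norml; lra.
Qed.

Let argE h c x : 0 < h -> h^-1 * x + - (h^-1 * c) = (x - c) / h.
Proof. by move=> h0; field; rewrite gt_eqF. Qed.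

Lemma plateau_neq0 h c1 c2 x : 0 < h -> c1 <= c2 ->
  plateau h c1 c2 x != 0 -> c1 - h <= x <= c2 + h.
Proof.
move=> h0 c12; apply: contraNT; rewrite negb_and -!ltNge => /orP[] hx.
- by rewrite /plateau /rescaled_step !argE// !step_le0 ?subrr// ler_pdivrMr//; lra.
- by rewrite /plateau /rescaled_step !argE// !step_ge1 ?subrr// ler_pdivlMr//; lra.
Qed.

Lemma mollifier_ge0 h c x : 0 < h -> 0 <= mollifier h c x.
Proof. by move=> h0; rewrite mulr_ge0 ?dstep_ge0// invr_ge0 ltW. Qed.

Lemma mollifier_eq0 h c x : 0 < h -> h <= `|x - c| -> mollifier h c x = 0.
Proof.
move=> h0 hx; rewrite /mollifier argE// dstep_eq0 ?mul0r//.
by rewrite normrM normfV (gtr0_norm h0) ler_pdivlMr// mul1r.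
Qed.

Lemma mollifier_continuous h c : continuous (mollifier h c).
Proof.
move=> x; apply: cvgM; last exact: cvg_cst.
apply: (@continuous_comp _ _ _ (fun y => h^-1 * y + - (h^-1 * c)) dstep).
  apply: cvgD; last exact: cvg_cst.
  by apply: cvgM; [exact: cvg_cst|exact: cvg_id].
exact: dstep_continuous.
Qed.

Lemma measurable_mollifier h c : measurable_fun [set: R] (mollifier h c).
Proof. exact: continuous_measurable_fun (@mollifier_continuous h c). Qed.

(** The fundamental theorem of calculus on the support, where the rescaled
    step increases from 0 to 1. *)
Lemma integral_mollifier h c : 0 < h ->
  (\int[lebesgue_measure]_x (mollifier h c x)%:E = 1)%E.
Proof.
move=> h0; transitivity
    (\int[lebesgue_measure]_(x in `[(c - h)%R, (c + h)%R]) (mollifier h c x)%:E)%E.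
  rewrite [RHS]integral_mkcond; apply: eq_integral => x _; rewrite patchE.
  case: ifPn => //; rewrite notin_setE/= in_itv/= => /negP hx.
  rewrite mollifier_eq0// ler_normr; move: hx; rewrite negb_and -!ltNge => /orP[]; lra.
rewrite (@continuous_FTC2 _ _ (rescaled_step h c)).
- rewrite /rescaled_step !argE// step_ge1 ?step_le0 ?sube0//.
    by rewrite ler_pdivrMr//; lra.
  by rewrite ler_pdivlMr//; lra.
- lra.
- exact/continuous_subspaceT/mollifier_continuous.
- have df x : derivable (rescaled_step h c) x 1.
    by have [] := is_derive_rescaled_step h c x.
  have cf x : {for x, continuous (rescaled_step h c)}.
    by apply/differentiable_continuous/derivable1_diffP.
  split => //.
  + exact: cvg_at_right_filter (cf _).
  + exact: cvg_at_left_filter (cf _).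
- move=> x _; rewrite derive1E.
  by have [_ ->] := is_derive_rescaled_step h c x.
Qed.

End mollifier.

(** * Product test functions *)

Section product_test_function.
Context {R : realType}.

(** Every iterated partial derivative of a product of functions of separate
    variables is again such a product, so smoothness in the plane reduces to
    smoothness in each variable. *)
Lemma iter_partial_product (w : seq bool) (a b : R -> R) :
    diffoo a -> diffoo b ->
  exists a' b', [/\ diffoo a', diffoo b' &
    iter_partial w (fun p => a p.1 * b p.2) = fun p => a' p.1 * b' p.2].
Proof.
move=> da db; elim: w => [|k w [a' [b' [da' db' IH]]]]; first by exists a, b.
case: k; rewrite /= IH.
- exists a'^`()%classic, b'; split => //; first exact: diffoo_derive1.
  apply/funext => p; rewrite /partial1/= !derive1E.
  have -> : (fun u => a' u * b' p.2) = b' p.2 *: a'.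
    by apply/funext => u; rewrite /GRing.scale/= mulrC.
  by rewrite deriveZ; [rewrite /GRing.scale/= mulrC|exact: diffoo_derivable].
- exists a', b'^`()%classic; split => //; first exact: diffoo_derive1.
  apply/funext => p; rewrite /partial2/= !derive1E.
  have -> : (fun u => a' p.1 * b' u) = a' p.1 *: b' by [].
  by rewrite deriveZ//; exact: diffoo_derivable.
Qed.

Lemma partial12_product (a b : R -> R) (p : R * R) : diffoo a -> diffoo b ->
  partial1 (partial2 (fun p => a p.1 * b p.2)) p =
  a^`()%classic p.1 * b^`()%classic p.2.
Proof.
move=> da db.
have -> : partial2 (fun p => a p.1 * b p.2) = fun p => a p.1 * b^`()%classic p.2.
  apply/funext => q; rewrite /partial2/= !derive1E.
  have -> : (fun u => a q.1 * b u) = a q.1 *: b by [].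
  by rewrite deriveZ//; exact: diffoo_derivable.
rewrite /partial1/= !derive1E.
have -> : (fun u => a u * 'D_1 b p.2) = 'D_1 b p.2 *: a.
  by apply/funext => u; rewrite /GRing.scale/= mulrC.
by rewrite deriveZ; [rewrite /GRing.scale/= mulrC|exact: diffoo_derivable].
Qed.

Lemma smooth_product (a b : R -> R) : diffoo a -> diffoo b ->
  smooth (fun p => a p.1 * b p.2).
Proof.
move=> da db w /=; have [a' [b' [da' db' ->]]] := iter_partial_product w da db.
split.
- move=> p; apply: cvgM.
  + apply: (@continuous_comp _ _ _ fst a'); first exact: cvg_fst.
    exact: diffoo_continuous.
  + apply: (@continuous_comp _ _ _ snd b'); first exact: cvg_snd.
    exact: diffoo_continuous.
- move=> p /=; have -> : (fun u => a' u * b' p.2) = b' p.2 *: a'.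
    by apply/funext => u; rewrite /GRing.scale/= mulrC.
  by apply: derivableZ; exact: diffoo_derivable.
- move=> p /=; have -> : (fun u => a' p.1 * b' u) = a' p.1 *: b' by [].
  by apply: derivableZ; exact: diffoo_derivable.
Qed.

Lemma test_function_product (U : set (R * R)) (a b : R -> R) (a1 a2 b1 b2 : R) :
  diffoo a -> diffoo b ->
  (forall x, a x != 0 -> a1 <= x <= a2) ->
  (forall x, b x != 0 -> b1 <= x <= b2) ->
  `[a1, a2] `*` `[b1, b2] `<=` U ->
  test_function U (fun p => a p.1 * b p.2).
Proof.
move=> da db ha hb HU.
have cK : compact (`[a1, a2] `*` `[b1, b2] : set (R * R)).
  by apply: compact_setX; exact: segment_compact.
have clK : closed (`[a1, a2] `*` `[b1, b2] : set (R * R)).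
  by apply: compact_closed => //; exact: hausdorff_prod.
have sub : closure [set p : R * R | a p.1 * b p.2 != 0] `<=`
    `[a1, a2] `*` `[b1, b2].
  rewrite [X in _ `<=` X](iffLR (closure_id _) clK); apply: closure_subset => p /=.
  by rewrite mulf_eq0 negb_or => /andP[/ha ? /hb ?]; split; rewrite /= in_itv.
split.
- exact: smooth_product.
- exact: subclosed_compact (@closed_closure _ _) cK sub.
- exact: subset_trans HU.
Qed.

End product_test_function.
(** * Increments over rectangles *)

Section rectangle_increment.
Context {R : realType}.

Lemma measurable_ge0 d (S : measurableType d) (g : S -> R) :
  measurable_fun [set: S] g -> measurable [set x | 0 <= g x].
Proof.
move=> mg; have -> : [set x | 0 <= g x] = [set: S] `&` g @^-1` `[0, +oo[.
  by apply/seteqP; split => x /=; rewrite in_itv/= andbT => // -[].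
exact: mg.
Qed.

Lemma measurable_diagonal : measurable (diagonal : set (R * R)).
Proof.
have -> : diagonal = [set p : R * R | 0 <= p.1 - p.2] `&` [set p | 0 <= p.2 - p.1].
  apply/seteqP; split => -[x y]; rewrite /diagonal/=; first by move=> ->; rewrite subrr.
  by move=> [? ?]; lra.
by apply: measurableI; apply: measurable_ge0; apply: measurable_funB.
Qed.

Local Notation leb := (@lebesgue_measure R).
Local Notation leb2 := (@lebesgue_measure R \x @lebesgue_measure R)%E.

Lemma norm_Rintegral_le_support d (S : measurableType d)
    (nu : {measure set S -> \bar R}) (U K : set S) (phi : S -> R) :
  measurable U -> measurable K -> nu.-integrable U (EFin \o phi) ->
  (forall x, `|phi x| <= 1) -> (forall x, phi x != 0 -> K x) ->
  (`|\int[nu]_(x in U) phi x|%:E <= nu K)%E.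
Proof.
move=> mU mK iphi phi1 phiK.
rewrite EFin_normr_Rintegral//.
have mphi := measurable_int _ iphi.
apply: (le_trans (le_abse_integral _ mU mphi)).
apply: (@le_trans _ _ (\int[nu]_(x in U) (\1_K x)%:E)%E).
  apply: ge0_le_integral => //.
  - by apply: measurableT_comp.
  - exact/measurable_EFinP/measurable_funTS/measurable_indic.
  - move=> x _ /=; rewrite lee_fin indicE.
    have [xK|xK] := boolP (x \in K); first exact: phi1.
    have -> : phi x = 0.
      by apply/eqP; apply: contraNT xK => /phiK; rewrite inE.
    by rewrite normr0.
rewrite integral_indic//; apply: le_measure; rewrite ?inE//.
exact: measurableI.
Qed.

Definition mollifier2 h s t (p : R * R) := mollifier h s p.1 * mollifier h t p.2.

Lemma mollifier2_ge0 h s t p : 0 < h -> 0 <= mollifier2 h s t p.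
Proof. by move=> h0; rewrite mulr_ge0 ?mollifier_ge0. Qed.

Lemma mollifier2_eq0 h s t p : 0 < h ->
  ~~ ((`|p.1 - s| <= h) && (`|p.2 - t| <= h)) -> mollifier2 h s t p = 0.
Proof.
move=> h0; rewrite negb_and -!ltNge => /orP[] hp.
  by rewrite /mollifier2 mollifier_eq0 ?mul0r// ltW.
by rewrite /mollifier2 [mollifier h t _]mollifier_eq0 ?mulr0// ltW.
Qed.

Lemma measurable_mollifier2 h s t : measurable_fun [set: R * R] (mollifier2 h s t).
Proof.
apply: measurable_funM.
  exact: (measurableT_comp (measurable_mollifier h s) measurable_fst).
exact: (measurableT_comp (measurable_mollifier h t) measurable_snd).
Qed.

Lemma integral_mollifier2 (U : set (R * R)) h s t : measurable U -> 0 < h ->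
  `[s - h, s + h] `*` `[t - h, t + h] `<=` U ->
  (\int[leb2]_(p in U) (mollifier2 h s t p)%:E = 1)%E.
Proof.
move=> mU h0 sU.
transitivity (\int[leb2]_p (mollifier2 h s t p)%:E)%E.
  rewrite integral_mkcond; apply: eq_integral => p _; rewrite patchE.
  case: ifPn => //; rewrite notin_setE => pU.
  rewrite mollifier2_eq0//; apply/negP => /andP[p1 p2]; apply: pU; apply: sU.
  by split; rewrite /= in_itv/= -ler_distlC distrC.
transitivity (\int[leb]_x fubini_F leb (EFin \o mollifier2 h s t) x)%E.
  apply: fubini_tonelli1; first by apply/measurable_EFinP; exact (measurable_mollifier2 h s t).
  by move=> p; rewrite lee_fin mollifier2_ge0.
rewrite /fubini_F/= -(integral_mollifier s h0); apply: eq_integral => x _.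
under eq_integral do rewrite /mollifier2/= EFinM.
rewrite ge0_integralZl_EFin ?mollifier_ge0//.
- by rewrite integral_mollifier// mule1.
- by move=> y _; rewrite lee_fin mollifier_ge0.
- by apply/measurable_EFinP; exact (measurable_mollifier h t).
Qed.

Lemma integrable_mollifier2 (U : set (R * R)) h s t : measurable U -> 0 < h ->
  `[s - h, s + h] `*` `[t - h, t + h] `<=` U ->
  leb2.-integrable U (EFin \o mollifier2 h s t).
Proof.
move=> mU h0 sU; apply/integrableP; split.
  apply/measurable_EFinP; apply: measurable_funTS.
  exact (measurable_mollifier2 h s t).
under eq_integral do rewrite gee0_abs ?lee_fin ?mollifier2_ge0//.
by rewrite integral_mollifier2// ltry.
Qed.


Lemma Rintegral_linear4 d (S : measurableType d) (nu : {measure set S -> \bar R})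
    (U : set S) (w1 w2 w3 w4 : S -> R) (a b c e : R) :
  measurable U ->
  nu.-integrable U (EFin \o w1) -> nu.-integrable U (EFin \o w2) ->
  nu.-integrable U (EFin \o w3) -> nu.-integrable U (EFin \o w4) ->
  nu.-integrable U
    (EFin \o (fun p => a * w1 p + b * w2 p + c * w3 p + e * w4 p)) /\
  \int[nu]_(p in U) (a * w1 p + b * w2 p + c * w3 p + e * w4 p) =
    a * (\int[nu]_(p in U) w1 p) + b * (\int[nu]_(p in U) w2 p) +
    c * (\int[nu]_(p in U) w3 p) + e * (\int[nu]_(p in U) w4 p).
Proof.
move=> mU i1 i2 i3 i4.
have iz k w : nu.-integrable U (EFin \o w) ->
    nu.-integrable U (EFin \o (fun p => k * w p)).
  by move=> iw; have := integrableZl mU k iw.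
have id u v : nu.-integrable U (EFin \o u) -> nu.-integrable U (EFin \o v) ->
    nu.-integrable U (EFin \o (fun p => u p + v p)).
  by move=> iu iv; have := integrableD mU iu iv.
split; first by do 3 (apply: (id (fun p => _)); last exact: iz); exact: iz.
rewrite !RintegralD ?RintegralZl//; do ?exact: iz.
  by apply: id; exact: iz.
by apply: (id (fun p => _)); [apply: id|]; exact: iz.
Qed.

(** Test the distributional identity against a product of plateaus with
    transition width [h]. On the side of [f] this yields the sum over the four
    corners of [f] averaged by a mollifier, which is close to the rectangular
    increment as [f] is continuous at the corners; on the side of [mu] the test
    function is bounded by 1 and supported in [K]. *)
Lemma rectangle_increment_le (Tmax : R) (f : R -> R -> R)
    (mu : signed_measure (R * R)%type R) (s1 s2 t1 t2 h0 : R) :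
  let K := `[s1 - h0, s2 + h0] `*` `[t1 - h0, t2 + h0] in
  mixed_derivative_is (open_square Tmax `\` diagonal) f mu ->
  s1 <= s2 -> t1 <= t2 -> 0 < h0 -> 0 < s1 - h0 -> s2 + h0 < t1 - h0 ->
  t2 + h0 < Tmax ->
  (forall s t e, s \in [:: s1; s2] -> t \in [:: t1; t2] -> 0 < e ->
    exists2 h, 0 < h & forall u v, `|u - s| <= h -> `|v - t| <= h ->
      `|f u v - f s t| <= e) ->
  (`|f s2 t2 - f s2 t1 - f s1 t2 + f s1 t1|%:E <= abs_measure mu K)%E.
Proof.
move=> K fmu s12 t12 h00 s1h st t2h cf.
set U := open_square Tmax `\` diagonal in fmu.
have mU : measurable U.
  apply: measurableD; first exact: measurableX.
  exact: measurable_diagonal.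
have mU' : @measurable _ (measurableTypeR R * measurableTypeR R)%type U.
  exact mU.
have mK : measurable K by exact: measurableX.
have KU : K `<=` U.
  move=> -[x y] [/= ]; rewrite !in_itv/= => /andP[x1 x2] /andP[y1 y2].
  split; first by split; rewrite /= in_itv/=; apply/andP; split; lra.
  by rewrite /diagonal/=; move: x1 x2 y1 y2 => /[swap] + + + + xy; rewrite ?xy; lra.
apply/lee_addgt0Pr => _/posnumP[e].
have e4 : 0 < e%:num / 4 by rewrite divr_gt0.
have ms1 : s1 \in [:: s1; s2] by rewrite !inE eqxx.
have ms2 : s2 \in [:: s1; s2] by rewrite !inE eqxx orbT.
have mt1 : t1 \in [:: t1; t2] by rewrite !inE eqxx.
have mt2 : t2 \in [:: t1; t2] by rewrite !inE eqxx orbT.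
have [h [h_gt0 hh0 cfh]] : exists h, [/\ 0 < h, h <= h0 &
    forall s t u v, s \in [:: s1; s2] -> t \in [:: t1; t2] ->
      `|u - s| <= h -> `|v - t| <= h -> `|f u v - f s t| <= e%:num / 4].
  have [h11 h11_gt0 H11] := cf s1 t1 _ ms1 mt1 e4.
  have [h12 h12_gt0 H12] := cf s1 t2 _ ms1 mt2 e4.
  have [h21 h21_gt0 H21] := cf s2 t1 _ ms2 mt1 e4.
  have [h22 h22_gt0 H22] := cf s2 t2 _ ms2 mt2 e4.
  exists (Num.min h0 (Num.min (Num.min h11 h12) (Num.min h21 h22))).
  split; first by rewrite !lt_min h00 h11_gt0 h12_gt0 h21_gt0.
    by rewrite ge_min lexx.
  move=> s t u v; rewrite !inE => /orP[]/eqP-> /orP[]/eqP->;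
    rewrite !le_min => /and3P[_ /andP[? ?] /andP[? ?]] /and3P[_ /andP[? ?] /andP[? ?]];
    by [exact: H11|exact: H12|exact: H21|exact: H22].
pose a := plateau h s1 s2; pose b := plateau h t1 t2.
pose phi p := a p.1 * b p.2.
have ha x : a x != 0 -> s1 - h0 <= x <= s2 + h0.
  by move=> /(plateau_neq0 h_gt0 s12) /andP[? ?]; apply/andP; split; lra.
have hb x : b x != 0 -> t1 - h0 <= x <= t2 + h0.
  by move=> /(plateau_neq0 h_gt0 t12) /andP[? ?]; apply/andP; split; lra.
have tphi : test_function U phi.
  apply: (test_function_product _ _ ha hb KU); exact: diffoo_plateau.
have [ifphi ipos ineg fphiE] := fmu phi tphi.
have phi1 p : `|phi p| <= 1.
  by rewrite normrM mulr_ile1 ?plateau_norm_le1.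
have phiK p : phi p != 0 -> K p.
  by rewrite mulf_eq0 negb_or => /andP[/ha ? /hb ?]; split; rewrite /= in_itv.
have box s t : s \in [:: s1; s2] -> t \in [:: t1; t2] ->
    `[s - h, s + h] `*` `[t - h, t + h] `<=` U.
  rewrite !inE => hs ht; apply: subset_trans KU; apply: setSX => x /=;
    rewrite !in_itv/= => /andP[x1 x2]; apply/andP; split.
  - by apply: le_trans x1; rewrite lerB//; case/orP: ht => /eqP->.
  - by apply: (le_trans x2); rewrite lerD//; case/orP: ht => /eqP->.
  - by apply: le_trans x1; rewrite lerB//; case/orP: hs => /eqP->.
  - by apply: (le_trans x2); rewrite lerD//; case/orP: hs => /eqP->.
have iw s t (hs : s \in [:: s1; s2]) (ht : t \in [:: t1; t2]) :=
  integrable_mollifier2 mU h_gt0 (box s t hs ht).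
have w1 s t (hs : s \in [:: s1; s2]) (ht : t \in [:: t1; t2]) :
    \int[leb2]_(p in U) mollifier2 h s t p = 1.
  by rewrite /Rintegral integral_mollifier2//; exact: box.
have [ik kE] := Rintegral_linear4 (f s2 t2) (- f s2 t1) (- f s1 t2) (f s1 t1) mU'
  (iw _ _ ms2 mt2) (iw _ _ ms2 mt1) (iw _ _ ms1 mt2) (iw _ _ ms1 mt1).
have [ie eE] := Rintegral_linear4 (e%:num / 4) (e%:num / 4) (e%:num / 4) (e%:num / 4) mU'
  (iw _ _ ms2 mt2) (iw _ _ ms2 mt1) (iw _ _ ms1 mt2) (iw _ _ ms1 mt1).
move: kE eE; rewrite !w1// !mulr1; set k := (fun p : R * R => _) in ik *.
set ew := (fun p : R * R => _) in ie * => kE eE.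
set g := (fun p : R * R => f p.1 p.2 * _) in fphiE ifphi.
(* pointwise, since each mollifier vanishes where f is far from its value at
   the corner *)
have gk p : `|k p - g p| <= ew p.
  rewrite /g partial12_product; [|exact: diffoo_plateau..].
  rewrite !plateau_derive1.
  have err s t : s \in [:: s1; s2] -> t \in [:: t1; t2] ->
      `|(f p.1 p.2 - f s t) * mollifier2 h s t p| <= e%:num / 4 * mollifier2 h s t p.
    move=> hs ht; rewrite normrM (ger0_norm (mollifier2_ge0 _ _ _ h_gt0)).
    have [/andP[? ?]|hp] := boolP ((`|p.1 - s| <= h) && (`|p.2 - t| <= h)).
      by rewrite ler_wpM2r ?mollifier2_ge0//; exact: cfh.
    by rewrite mollifier2_eq0// !mulr0.
  move: (err _ _ ms2 mt2) (err _ _ ms2 mt1) (err _ _ ms1 mt2) (err _ _ ms1 mt1).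
  rewrite /k /ew; have -> : (mollifier h s1 p.1 - mollifier h s2 p.1) *
      (mollifier h t1 p.2 - mollifier h t2 p.2) =
      mollifier2 h s2 t2 p - mollifier2 h s2 t1 p - mollifier2 h s1 t2 p +
      mollifier2 h s1 t1 p by rewrite /mollifier2; ring.
  move: (mollifier2 h s2 t2 p) (mollifier2 h s2 t1 p) (mollifier2 h s1 t2 p)
    (mollifier2 h s1 t1 p) (f p.1 p.2) => w22 w21 w12 w11 fp e22 e21 e12 e11.
  have -> : f s2 t2 * w22 + - f s2 t1 * w21 + - f s1 t2 * w12 + f s1 t1 * w11 -
      fp * (w22 - w21 - w12 + w11) =
      - ((fp - f s2 t2) * w22) + (fp - f s2 t1) * w21 +
      (fp - f s1 t2) * w12 - (fp - f s1 t1) * w11 by ring.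
  rewrite -(normrN ((fp - f s2 t2) * w22)) in e22.
  rewrite -(normrN ((fp - f s1 t1) * w11)) in e11.
  do 3 (apply: le_trans (ler_normD _ _) _; apply: lerD => //).
have le1 : `|\int[leb2]_(p in U) k p| <= e%:num + `|\int[leb2]_(p in U) g p|.
  have -> : \int[leb2]_(p in U) k p =
      \int[leb2]_(p in U) (k p - g p) + \int[leb2]_(p in U) g p.
    by rewrite RintegralB// subrK.
  apply: le_trans (ler_normD _ _) _; rewrite lerD2r.
  have ikg : leb2.-integrable U (EFin \o (fun p => k p - g p)).
    by have := integrableB mU' ik ifphi.
  apply: le_trans (le_normr_Rintegral mU' ikg) _.
  have -> : e%:num = e%:num / 4 + e%:num / 4 + e%:num / 4 + e%:num / 4 by field.
  rewrite -eE; apply: le_Rintegral => //.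
  by have := integrable_norm ikg.
have kE' : \int[leb2]_(p in U) k p = f s2 t2 - f s2 t1 - f s1 t2 + f s1 t1.
  by rewrite kE.
rewrite kE' in le1.
apply: (@le_trans _ _ (e%:num + `|\int[leb2]_(p in U) g p|)%:E).
  by rewrite lee_fin.
rewrite EFinD addeC leeD2r// fphiE.
apply: (@le_trans _ _ (`|\int[spos mu]_(p in U) phi p|%:E +
  `|\int[sneg mu]_(p in U) phi p|%:E)%E).
  by rewrite -EFinD lee_fin ler_normB.
by rewrite /abs_measure; apply: leeD; apply: norm_Rintegral_le_support.
Qed.

End rectangle_increment.
(** * Moments of Gaussian variables *)

Section standard_normal.
Context {R : realType}.
Local Notation leb := (@lebesgue_measure R).
Local Notation N01 := (@normal_prob R 0 1).
Local Open Scope ereal_scope.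

(** The density is a Radon-Nikodym derivative, and those are unique almost
    everywhere. *)
Lemma ge0_integral_normal_prob (m s : R) (g : R -> \bar R) :
  measurable_fun [set: R] g -> (forall x, 0 <= g x) ->
  \int[normal_prob m s]_x g x = \int[leb]_x (g x * (normal_pdf m s x)%:E).
Proof.
move=> mg g0; have dom := normal_prob_dominates m s.
rewrite -(Radon_Nikodym_SigmaFinite.change_of_variables dom g0)//.
have mf := measurable_int _ (Radon_Nikodym_SigmaFinite.f_integrable dom).
apply: ae_eq_integral => //.
- exact: emeasurable_funM.
- apply: emeasurable_funM => //.
  by apply/measurable_EFinP; exact (measurable_normal_pdf m s).
- apply: ae_eqe_mul2l; apply: integral_ae_eq => //.
  + exact: Radon_Nikodym_SigmaFinite.f_integrable.
  + by apply/measurable_EFinP; exact (measurable_normal_pdf m s).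
  + by move=> E _ mE; rewrite -Radon_Nikodym_SigmaFinite.f_integral.
Qed.

Lemma normal_pdf_rescale (m s z : R) : (0 < s)%R ->
  (normal_pdf m s (m + s * z) * s = normal_pdf 0 1 z)%R.
Proof.
move=> s0; rewrite !normal_pdfE ?gt_eqF ?oner_neq0//.
rewrite /normal_fun /normal_peak subr0 expr1n mul1r.
have -> : (- (m + s * z - m) ^+ 2 / (s ^+ 2 *+ 2) = - z ^+ 2 / (1 *+ 2))%R.
  by field; rewrite gt_eqF.
rewrite -mulrnAr sqrtrM ?sqr_ge0// sqrtr_sqr gtr0_norm// invfM.
set q := (Num.sqrt _)^-1%R; rewrite mulrAC; congr (_ * _)%R.
by rewrite mulrAC mulVf ?gt_eqF// mul1r.
Qed.

Lemma normal_prob_rescale (m s : R) (g : R -> R) : (0 < s)%R ->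
  continuous g -> (forall x, 0 <= g x)%R ->
  \int[normal_prob m s]_x (g x)%:E = \int[N01]_z (g (m + s * z))%:E.
Proof.
move=> s0 cg g0.
have caff : continuous (fun z : R => m + s * z)%R.
  move=> z; apply: cvgD; first exact: cvg_cst.
  by apply: cvgM; [exact: cvg_cst|exact: cvg_id].
have mg : measurable_fun [set: R] (EFin \o g).
  by apply/measurable_EFinP; exact (continuous_measurable_fun cg).
have mga : measurable_fun [set: R] (EFin \o (fun z => g (m + s * z)%R)).
  apply/measurable_EFinP; apply: continuous_measurable_fun => z.
  by apply: (@continuous_comp _ _ _ (fun z : R => m + s * z)%R g);
    [exact: caff|exact: cg].
rewrite (ge0_integral_normal_prob m s mg); last by move=> x; rewrite lee_fin.
rewrite (ge0_integral_normal_prob 0 1 mga); last by move=> x; rewrite lee_fin.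
have dF (x : R) : is_derive x 1%R (fun z : R => m + s * z)%R s.
  have h1 := is_deriveD (is_derive_cst m x 1%R)
    (is_deriveM (is_derive_cst s x 1%R) (is_derive_id x 1%R)).
  apply: is_derive_eq h1 _.
  by rewrite scaler0 addr0 add0r /GRing.scale/= mulr1.
have dFE : derive1 (fun z : R => m + s * z)%R = cst s.
  by apply/funext => x; rewrite derive1E; have [_ ->] := dF x.
under eq_integral do rewrite -EFinM.
rewrite (@increasing_ge0_integration_by_substitutionT _ (fun z => m + s * z)%R
  (fun x => g x * normal_pdf m s x)%R).
- apply: eq_integral => z _; rewrite -EFinM; congr EFin.
  rewrite dFE -(normal_pdf_rescale m z s0).
  by rewrite -[LHS]/(g (m + s * z) * normal_pdf m s (m + s * z) * s)%R mulrA.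
- by move=> x y xy; rewrite ltrD2l ltr_pM2l.
- by rewrite dFE => x; exact: cvg_cst.
- by rewrite dFE; exact: is_cvg_cst.
- by rewrite dFE; exact: is_cvg_cst.
- by move=> x; have [] := dF x.
- apply/cvgrNyPle => A; near=> x.
  rewrite -lerBrDl mulrC -ler_pdivlMr//; near: x.
- apply/cvgryPge => A; near=> x.
  rewrite -lerBlDl mulrC -ler_pdivrMr//; near: x.
- move=> x; apply: cvgM; first exact: cg.
  by apply: continuous_normal_pdf; rewrite gt_eqF.
- by move=> x; rewrite mulr_ge0// normal_pdf_ge0.
Unshelve. all: by end_near. Qed.

Definition normal_moment (k : nat) : \bar R := \int[N01]_z (z ^+ k.*2)%:E.

Lemma normal_moment_ge0 k : 0 <= normal_moment k.
Proof.
by apply: integral_ge0 => z _; rewrite lee_fin -mul2n exprM exprn_ge0 ?sqr_ge0.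
Qed.

Lemma expr_le_expR (y : R) k : (0 <= y -> y ^+ k <= k`!%:R * expR y)%R.
Proof.
move=> y0; case: k => [|k].
  by rewrite expr0 fact0 mul1r; have := expR_ge1Dx y; lra.
have := expR_ge1Dxn k y0 => h.
rewrite mulrC -ler_pdivrMr ?ltr0n ?fact_gt0//; lra.
Qed.

(** With [y = z^2/4], the bound [y^k <= k! exp y] absorbs the power into half of
    the Gaussian exponent, leaving a normal density of variance 2. *)
Lemma normal_moment_lty k : normal_moment k < +oo.
Proof.
rewrite /normal_moment ge0_integral_normal_prob; last 2 first.
- by apply/measurable_EFinP; exact: measurable_funX.
- by move=> z; rewrite lee_fin -mul2n exprM exprn_ge0 ?sqr_ge0.
pose t := Num.sqrt 2 : R; have t0 : (0 < t)%R by rewrite sqrtr_gt0.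
have t2 : (t ^+ 2 = 2)%R by rewrite sqr_sqrtr.
pose c : R := (4 ^+ k * k`!%:R * normal_peak 1 / normal_peak t)%R.
have peak0 : (0 < normal_peak t :> R)%R by rewrite normal_peak_gt0// gt_eqF.
apply: (@le_lt_trans _ _ (\int[leb]_z (c * normal_pdf 0 t z)%:E)).
  apply: ge0_le_integral => //.
  - move=> z _; rewrite -EFinM lee_fin mulr_ge0 ?normal_pdf_ge0//.
    by rewrite -mul2n exprM exprn_ge0 ?sqr_ge0.
  - apply: emeasurable_funM; first by apply/measurable_EFinP; exact: measurable_funX.
    by apply/measurable_EFinP; exact (measurable_normal_pdf _ _).
  - apply/measurable_EFinP; apply: measurable_funM => //.
    exact (measurable_normal_pdf _ _).
  - move=> z _; rewrite -EFinM lee_fin.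
    rewrite !normal_pdfE ?gt_eqF ?oner_neq0// /normal_fun subr0 t2 expr1n.
    have -> : (c * (normal_peak t * expR (- z ^+ 2 / (2 *+ 2))) =
      4 ^+ k * k`!%:R * expR (- z ^+ 2 / (2 *+ 2)) * normal_peak 1)%R.
      by rewrite /c; field; rewrite gt_eqF.
    rewrite mulrCA mulrC ler_wpM2r ?normal_peak_ge0//.
    pose y := (z ^+ 2 / 4)%R; have y0 : (0 <= y)%R by rewrite divr_ge0 ?sqr_ge0.
    have -> : (- z ^+ 2 / (1 *+ 2) = - y + - y)%R by rewrite /y; field.
    have -> : (- z ^+ 2 / (2 *+ 2) = - y)%R by rewrite /y; field.
    have -> : (z ^+ k.*2 = 4 ^+ k * y ^+ k)%R.
      by rewrite -mul2n exprM -exprMn; congr (_ ^+ _)%R; rewrite /y; field.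
    rewrite -!mulrA ler_wpM2l ?exprn_ge0// expRD mulrA.
    rewrite ler_wpM2r ?expR_ge0// expRN ler_pdivrMr ?expR_gt0//.
    exact: expr_le_expR.
under eq_integral do rewrite EFinM.
rewrite integralZl//; last exact: integrable_normal_pdf.
by rewrite integral_normal_pdf mule1 ltry.
Qed.

Lemma normal_moment_fin_num k : normal_moment k \is a fin_num.
Proof. by rewrite ge0_fin_numE ?normal_moment_ge0// normal_moment_lty. Qed.

Lemma integrable_normal_id : N01.-integrable [set: R] (EFin \o (@id R)).
Proof.
apply/integrableP; split; first exact/measurable_EFinP.
apply: (@le_lt_trans _ _ (\int[N01]_z ((1 + z ^+ 2)%R)%:E)).
  apply: ge0_le_integral => //.
  - by apply: measurableT_comp => //; apply/measurable_EFinP; exact: measurable_id.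
  - have m1 : measurable_fun [set: R] (fun z : R => 1 + z ^+ 2)%R.
      by apply: measurable_funD => //; exact: measurable_funX.
    by apply/measurable_EFinP; exact m1.
  - move=> z _ /=; rewrite lee_fin; have := sqr_ge0 (`|z| - 1)%R.
    by rewrite sqrrB1 real_normK ?num_real; have := normr_ge0 z; lra.
under eq_integral do rewrite EFinD.
rewrite ge0_integralD//; last 2 first.
- by move=> z _; rewrite lee_fin sqr_ge0.
- by apply/measurable_EFinP; exact: measurable_funX.
rewrite integral_cst//= probability_setT mule1 lte_add_pinfty ?ltry//.
exact: (normal_moment_lty 1).
Qed.

(** The law is invariant under [z |-> -z], hence the mean equals its opposite. *)
Lemma integral_normal_id : \int[N01]_z z%:E = 0.
Proof.
have sym (A : set R) : measurable A ->
    pushforward N01 (-%R : _ -> measurableTypeR R) A = N01 A.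
  move=> mA.
  have mN : measurable (-%R @^-1` A : set (measurableTypeR R)).
    rewrite -[_ @^-1` _]setTI; exact: (@oppr_measurable R setT).
  rewrite /pushforward /normal_prob.
  transitivity (\int[pushforward leb (-%R : _ -> measurableTypeR R)]_(x in A)
      (normal_pdf 0 1 x)%:E); last first.
    by apply: eq_measure_integral => B mB _; exact (lebesgue_measureN mB).
  symmetry; etransitivity.
    apply: ge0_integral_pushforward => //.
    - apply/measurable_EFinP; apply: measurable_funTS.
      exact (measurable_normal_pdf 0 1).
    - by move=> y _; rewrite lee_fin normal_pdf_ge0.
  apply: eq_integral => x _ /=; congr EFin.
  by rewrite !normal_pdfE ?oner_neq0// /normal_fun !subr0 sqrrN.
have fin := integrable_fin_num measurableT integrable_normal_id.
have : \int[N01]_z z%:E = - \int[N01]_z z%:E.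
  transitivity (\int[pushforward N01 (-%R : _ -> measurableTypeR R)]_z z%:E).
    by apply: eq_measure_integral => B mB _; apply/esym; exact (sym B mB).
  etransitivity; first apply: integral_pushforward => //.
    rewrite preimage_setT (_ : _ \o _ = -%E \o (EFin \o id)); last by apply/funext.
    by apply: integrableN => //; exact integrable_normal_id.
  rewrite preimage_setT /= -integralN//.
  by apply: integrable_add_def => //; exact integrable_normal_id.
by move: fin => /=; case: (\int[N01]_z z%:E)%E => //= r _ [] r0; congr EFin; lra.
Qed.

End standard_normal.
(** * Coefficients of powers of a quadratic polynomial *)

Section quadratic_power.
Context {R : realFieldType}.
Implicit Types A B D th : R.

Lemma coef_even_quadratic_power A B n j :
  ((A *: 'X^2 + B%:P) ^+ n)`_j =
  \sum_(i < n.+1) (A ^+ (n - i) * B ^+ i *+ 'C(n, i)) * (j == 2 * (n - i))%N%:R.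
Proof.
rewrite exprDn coef_sum; apply: eq_bigr => i _.
rewrite exprZn -exprM -rmorphXn coefMn -scalerAl coefZ coefMC coefXn.
by rewrite [RHS]mulrnAl -mulrA [B ^+ i * _]mulrC.
Qed.

Lemma coef_even_quadratic_power_le A B D n j : 0 <= A <= D -> 0 <= B <= D ->
  `|((A *: 'X^2 + B%:P) ^+ n)`_j| <= (2 * D) ^+ n.
Proof.
move=> /andP[A0 AD] /andP[B0 BD].
rewrite coef_even_quadratic_power; apply: le_trans (ler_norm_sum _ _ _) _.
apply: (@le_trans _ _ ((A + B) ^+ n)); last first.
  by rewrite lerXn2r ?nnegrE//; lra.
rewrite exprDn; apply: ler_sum => i _.
have t0 : 0 <= A ^+ (n - i) * B ^+ i *+ 'C(n, i).
  by rewrite mulrn_wge0// mulr_ge0// exprn_ge0.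
rewrite normrM (ger0_norm t0) -[leRHS]mulr1 ler_wpM2l//.
by case: (_ == _); rewrite ?normr0 ?normr1.
Qed.

Lemma coef_even_quadratic_power_odd A B n j : odd j ->
  ((A *: 'X^2 + B%:P) ^+ n)`_j = 0.
Proof.
move=> oj; rewrite coef_even_quadratic_power big1// => i _.
case: eqP => [ji|_]; last by rewrite mulr0.
by move: oj; rewrite ji oddM.
Qed.

(** Expand in powers of [2 th 'X]: the term of degree 0 in [th] is an even
    polynomial and does not contribute to the odd degree [m], and every other
    term contains a factor [th]. The constant [4 ^+ m] is the value at 1 of the
    dominating sum [\sum_i 'C(m, i) 2 ^+ m]. *)
Lemma coef_quadratic_power_le A B D th m : odd m ->
  0 <= A <= D -> 0 <= B <= D -> `|th| <= D ->
  `|((A *: 'X^2 + (2 * th) *: 'X + B%:P) ^+ m)`_m| <=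
    4 ^+ m * D ^+ m.-1 * `|th|.
Proof.
move=> om hA hB hth.
have D0 : 0 <= D by exact: le_trans hth.
have -> : A *: 'X^2 + (2 * th) *: 'X + B%:P =
    (A *: 'X^2 + B%:P) + (2 * th) *: 'X by rewrite addrAC.
rewrite exprDn coef_sum; apply: le_trans (ler_norm_sum _ _ _) _.
have -> : 4 ^+ m * D ^+ m.-1 * `|th| =
    \sum_(i < m.+1) (2 ^+ m * D ^+ m.-1 * `|th|) *+ 'C(m, i).
  rewrite sumrMnr (_ : 4 = 2 * 2); last by rewrite -natrM.
  have -> : (\sum_(i < m.+1) 'C(m, i) = 2 ^ m)%N.
    rewrite -[2%N]/(1 + 1)%N expnDn; apply: eq_bigr => i _.
    by rewrite !exp1n !muln1.
  by rewrite exprMn -[RHS]mulr_natl natrX !mulrA.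
apply: ler_sum => -[i /=]; rewrite ltnS => im _.
rewrite coefMn normrMn lerMn2r; apply/orP; right.
rewrite exprZn -scalerAr coefZ coefMXn ltnNge im/=.
case: i im => [|i] im.
  rewrite subn0 coef_even_quadratic_power_odd// mulr0 normr0.
  by rewrite !mulr_ge0// exprn_ge0.
rewrite normrM normrX normrM ger0_norm// exprMn.
have h1 := coef_even_quadratic_power_le (m - i.+1) (m - i.+1) hA hB.
have h2 : 2 ^+ i.+1 * `|th| ^+ i.+1 <= 2 ^+ i.+1 * (D ^+ i * `|th|).
  by rewrite ler_wpM2l ?exprn_ge0// exprSr ler_wpM2r// lerXn2r ?nnegrE.
apply: le_trans (ler_pM _ _ h2 h1) _ => //.
rewrite exprMn le_eqVlt; apply/orP; left; apply/eqP.
have -> : m.-1 = (i + (m - i.+1))%N.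
  by case: m im {om h1} => // m' im; rewrite subSS subnKC.
have -> : (2 : R) ^+ m = 2 ^+ i.+1 * 2 ^+ (m - i.+1) by rewrite -exprD subnKC.
by rewrite [D ^+ (i + _)]exprD; ring.
Qed.

Lemma poly_eq_of_horner (p q : {poly R}) : (forall x, p.[x] = q.[x]) -> p = q.
Proof.
move=> pq; apply/eqP; rewrite -subr_eq0; apply: contraT => pq0.
have := max_poly_roots (rs := [seq (i%:R : R) | i <- iota 0 (size (p - q))]) pq0.
rewrite size_map size_iota ltnn => /(_ _ _) -> //.
- by apply/allP => x _; rewrite /root !hornerE pq subrr.
- rewrite map_inj_uniq ?iota_uniq// => a b /eqP; rewrite eqr_nat => /eqP //.
Qed.

End quadratic_power.
(** * Gaussian pairs *)

Section gaussian_variables.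
Context {R : realType} d (Omega : measurableType d) (P : probability Omega R).
Local Notation N01 := (@normal_prob R 0 1).
Implicit Types Y U V : Omega -> R.
Local Open Scope ereal_scope.

(** Both cases of the definition of [gaussian] are covered by the
    representation of the law as that of [m + s Z] with [Z] standard normal. *)
Lemma gaussian_integral Y : measurable_fun [set: Omega] Y -> gaussian P Y ->
  exists m s : R, [/\ (0 <= s)%R & forall g : R -> R, continuous g ->
    (forall x, 0 <= g x)%R ->
    \int[P]_w (g (Y w))%:E = \int[N01]_z (g (m + s * z))%:E].
Proof.
move=> mY [m [s [s0 lawY]]]; exists m, s; split=> // g cg g0.
have mY' : measurable_fun [set: Omega] (Y : Omega -> measurableTypeR R).
  exact mY.
have mg : measurable_fun [set: measurableTypeR R] (EFin \o g).
  by apply/measurable_EFinP; exact (continuous_measurable_fun cg).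
have := @ge0_integral_pushforward _ _ _ (measurableTypeR R) R Y mY' P setT
  (EFin \o g) measurableT mg.
rewrite preimage_setT => <-; last by move=> y _; rewrite lee_fin.
have [s_eq0|s_neq0] := eqVneq s 0%R.
- transitivity (\int[@dirac _ (measurableTypeR R) m R]_y (g y)%:E).
    apply: eq_measure_integral => A mA _; etransitivity; first exact (lawY A mA).
    by rewrite s_eq0 eqxx.
  rewrite integral_dirac// diracT mul1e.
  transitivity (\int[N01]_z (g m)%:E).
    by rewrite integral_cst//= probability_setT mule1.
  by apply: eq_integral => z _; rewrite s_eq0 mul0r addr0.
- rewrite -normal_prob_rescale// ?lt_neqAle ?[0%R == s]eq_sym ?s_neq0//.
  apply: eq_measure_integral => A mA _; etransitivity; first exact (lawY A mA).
  by rewrite (negbTE s_neq0).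
Qed.

Lemma exprn_double_ge0 (x : R) k : (0 <= x ^+ k.*2)%R.
Proof. by rewrite -mul2n exprM exprn_ge0 ?sqr_ge0. Qed.

Lemma continuous_exprn k : continuous (fun x : R => x ^+ k)%R.
Proof. by move=> x; exact: exprn_continuous. Qed.

(** Otherwise the standard normal law would be carried by the origin, which is
    Lebesgue negligible. *)
Lemma normal_moment1_gt0 : 0 < @normal_moment R 1.
Proof.
rewrite lt_neqAle normal_moment_ge0 andbT eq_sym; apply/eqP => m0.
have : \int[N01]_z `|(z ^+ 2)%:E| = 0.
  rewrite -[RHS]m0; apply: eq_integral => z _.
  by rewrite gee0_abs// lee_fin sqr_ge0.
have mz : measurable_fun [set: measurableTypeR R] (fun z : R => (z ^+ 2)%:E).
  by apply/measurable_EFinP; exact: measurable_funX.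
move=> /(ae_eq_integral_abs N01 measurableT mz).1 ae0.
have N0 : N01 [set 0%R] = 0.
  have /null_content_dominatesP := @normal_prob_dominates R 0 1.
  apply; first exact (measurable_set1 (0%R : R)).
  exact (lebesgue_measure_set1 (0%R : R)).
have [A [mA A0 sA]] := ae0.
have : N01 [set: measurableTypeR R] <= N01 (A `|` [set 0%R]).
  apply: le_measure; rewrite ?inE//; first exact: measurableU.
  move=> z _; have [->|z0] := eqVneq z 0%R; first by right.
  left; apply: sA => /(_ I)/= [] /eqP; rewrite expf_eq0/= => z0'.
  by rewrite z0' in z0.
rewrite probability_setT leNgt => /negP; apply.
apply: (@le_lt_trans _ _ (N01 A + N01 [set 0%R])).
  exact: measureU2.
by rewrite A0 N0 adde0 lte01.
Qed.

(** The number [(2 k - 1)!!], in the form of a normalized moment, so that neither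
    this closed form nor the value 1 of the second moment has to be known. *)
Definition gauss_const k : R :=
  (fine (@normal_moment R k) / fine (@normal_moment R 1) ^+ k)%R.

Lemma gauss_const_ge0 k : (0 <= gauss_const k)%R.
Proof. by rewrite divr_ge0 ?exprn_ge0// fine_ge0// normal_moment_ge0. Qed.

Lemma fine_normal_momentK k : (fine (@normal_moment R k))%:E = normal_moment k.
Proof. by rewrite fineK// normal_moment_fin_num. Qed.

Lemma gaussian_centered Y : measurable_fun [set: Omega] Y -> gaussian P Y ->
    'E_P[Y] = 0 ->
  exists2 s : R, (0 <= s)%R & forall k,
    \int[P]_w (Y w ^+ k.*2)%:E = normal_moment k * (s ^+ k.*2)%:E.
Proof.
move=> mY gY EY; have [m [s [s0 intY]]] := gaussian_integral mY gY.
have cpos : continuous (fun x : R => Num.max x 0)%R.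
  by move=> x; apply: continuous_max; [exact: cvg_id|exact: cvg_cst].
have cneg : continuous (fun x : R => Num.max (- x) 0)%R.
  move=> x; apply: continuous_max; last exact: cvg_cst.
  by apply: cvgN; exact: cvg_id.
have m0 : m = 0%R.
  have eE : \int[P]_w (Y w)%:E = \int[N01]_z (m + s * z)%:E.
    rewrite integralE [RHS]integralE; congr (_ - _).
    - transitivity (\int[P]_w (Num.max (Y w) 0)%:E).
        by apply: eq_integral => w _; rewrite funeposE EFin_max.
      rewrite (intY _ cpos); last by move=> x; rewrite le_max lexx orbT.
      by apply: eq_integral => w _; rewrite funeposE EFin_max.
    - transitivity (\int[P]_w (Num.max (- Y w) 0)%:E).
        by apply: eq_integral => w _; rewrite funenegE EFin_max.
      rewrite (intY _ cneg); last by move=> x; rewrite le_max lexx orbT.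
      by apply: eq_integral => w _; rewrite funenegE EFin_max.
  move: EY; rewrite unlock eE.
  under eq_integral do rewrite EFinD EFinM.
  rewrite integralD//.
  - rewrite integral_cst//= probability_setT mule1 integralZl//.
      by rewrite integral_normal_id mule0 adde0 => -[].
    exact integrable_normal_id.
  - by apply: finite_measure_integrable_cst.
  - apply: integrableZl => //; exact integrable_normal_id.
exists s => // k; rewrite (intY _ (@continuous_exprn _)); last first.
  by move=> x; exact: exprn_double_ge0.
rewrite m0; under eq_integral do rewrite add0r exprMn EFinM.
rewrite ge0_integralZl_EFin ?exprn_double_ge0//; first by rewrite muleC.
  by move=> z _; rewrite lee_fin exprn_double_ge0.
by apply/measurable_EFinP; exact: measurable_funX.
Qed.

Lemma gaussian_even_moment Y k : measurable_fun [set: Omega] Y ->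
    gaussian P Y -> 'E_P[Y] = 0 ->
  P.-integrable [set: Omega] (EFin \o (fun w => Y w ^+ k.*2)%R) /\
  (\int[P]_w (Y w ^+ k.*2) = gauss_const k * (\int[P]_w (Y w ^+ 2)) ^+ k)%R.
Proof.
move=> mY gY EY; have [s s0 intY] := gaussian_centered mY gY EY.
have RE j : (\int[P]_w (Y w ^+ j.*2) = fine (@normal_moment R j) * s ^+ j.*2)%R.
  by rewrite /Rintegral intY -fine_normal_momentK.
split.
  apply/integrableP; split.
    by apply/measurable_EFinP; exact: measurable_funX.
  under eq_integral do rewrite gee0_abs ?lee_fin ?exprn_double_ge0//.
  by rewrite intY -fine_normal_momentK -EFinM ltry.
rewrite RE -[2%N]/(1.*2) RE /gauss_const exprMn -exprM.
rewrite (_ : (1.*2 * k)%N = k.*2); last by rewrite -[k.*2]mul2n.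
rewrite mulrA divfK// expf_neq0// gt_eqF// fine_gt0//.
by rewrite normal_moment1_gt0 normal_moment_lty.
Qed.

End gaussian_variables.
Section bivariate_gaussian.
Context {R : realType} d (Omega : measurableType d) (P : probability Omega R).
Implicit Types U V : Omega -> R.

Lemma Rintegral_sum (S : finType) (F : S -> Omega -> R) :
  (forall i, P.-integrable [set: Omega] (EFin \o F i)) ->
  \int[P]_w (\sum_i F i w) = \sum_i \int[P]_w F i w.
Proof.
move=> iF; rewrite /Rintegral.
under eq_integral do rewrite -sumEFin.
rewrite (integral_sum measurableT iF) -sum_fine// => i _.
by have := integrable_fin_num measurableT (iF i).
Qed.

Lemma norm_monomial_le (x y : R) j k l : (j + k)%N = l.*2 ->
  `|x ^+ j * y ^+ k| <= x ^+ l.*2 + y ^+ l.*2.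
Proof.
move=> jk.
have E (z : R) : z ^+ l.*2 = `|z| ^+ l.*2.
  by rewrite -mul2n !exprM real_normK ?num_real.
rewrite normrM !normrX (E x) (E y) -jk.
have aux (u v : R) : 0 <= u -> u <= v -> u ^+ j * v ^+ k <= v ^+ (j + k).
  by move=> u0 uv; rewrite exprD ler_wpM2r ?exprn_ge0 ?(le_trans u0)// lerXn2r ?nnegrE ?(le_trans u0).
have aux' (u v : R) : 0 <= v -> v <= u -> u ^+ j * v ^+ k <= u ^+ (j + k).
  by move=> u0 uv; rewrite exprD ler_wpM2l ?exprn_ge0 ?(le_trans u0)// lerXn2r ?nnegrE ?(le_trans u0).
have [xy|yx] := leP `|x| `|y|.
  by apply: le_trans (aux _ _ _ xy) _ => //; rewrite lerDr exprn_ge0.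
by apply: le_trans (aux' _ _ _ (ltW yx)) _ => //; rewrite lerDl exprn_ge0.
Qed.

Definition centered_gaussian_pair U V := forall a b : R,
  gaussian P (fun w => a * U w + b * V w) /\
  ('E_P[fun w => (a * U w + b * V w)%R] = 0)%E.

Variables (U V : Omega -> R).
Hypotheses (mU : measurable_fun [set: Omega] U)
  (mV : measurable_fun [set: Omega] V) (gUV : centered_gaussian_pair U V).

Let m1 (a b : R) : measurable_fun [set: Omega] (fun w => a * U w + b * V w).
Proof. by apply: measurable_funD; apply: measurable_funM. Qed.

Lemma gaussian_monomial_integrable j k l : (j + k)%N = l.*2 ->
  P.-integrable [set: Omega] (EFin \o (fun w => U w ^+ j * V w ^+ k)).
Proof.
move=> jk.
have [gU EU] := gUV 1 0; have [gV EV] := gUV 0 1.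
have [iU _] := gaussian_even_moment l (m1 1 0) gU EU.
have [iV _] := gaussian_even_moment l (m1 0 1) gV EV.
apply: le_integrable (integrableD _ iU iV) => //.
  by apply/measurable_EFinP; apply: measurable_funM; exact: measurable_funX.
move=> w _ /=; rewrite lee_fin !mul1r !mul0r addr0 add0r.
by rewrite (le_trans (norm_monomial_le _ _ jk))// ler_norm.
Qed.

Let Ex (f : Omega -> R) := \int[P]_w f w.

Lemma gaussian_moment_expansion (a : R) l :
  Ex (fun w => (a * U w + 1 * V w) ^+ l.*2) =
  \sum_(i < (l.*2).+1) (a ^+ (l.*2 - i) * Ex (fun w => U w ^+ (l.*2 - i) * V w ^+ i)) *+ 'C(l.*2, i).
Proof.
have im (i : 'I_(l.*2).+1) := @gaussian_monomial_integrable (l.*2 - i) i l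
  (subnK (leq_ord i)).
rewrite /Ex; transitivity (\int[P]_w (\sum_(i < (l.*2).+1)
    (a ^+ (l.*2 - i) *+ 'C(l.*2, i)) * (U w ^+ (l.*2 - i) * V w ^+ i))).
  apply: eq_Rintegral => w _; rewrite exprDn; apply: eq_bigr => i _.
  by rewrite mul1r exprMn mulrnAl mulrA.
rewrite Rintegral_sum; last first.
  by move=> i; have := integrableZl measurableT (a ^+ (l.*2 - i) *+ 'C(l.*2, i)) (im i).
by apply: eq_bigr => i _; rewrite RintegralZl//= mulrnAl.
Qed.

(** The polynomials [p] and [q] in [a] agree because both give the moment of
    order [2 m] of [a U + V]: [p] by the binomial expansion, [q] as a multiple
    of the [m]-th power of the variance. Their coefficients of degree [m] give
    the claim. *)
Lemma gaussian_odd_moment_le m D : odd m ->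
  Ex (fun w => U w ^+ 2) <= D -> Ex (fun w => V w ^+ 2) <= D ->
  `|Ex (fun w => U w * V w)| <= D ->
  `|Ex (fun w => U w ^+ m * V w ^+ m)| <=
    gauss_const m * 4 ^+ m * D ^+ m.-1 * `|Ex (fun w => U w * V w)|.
Proof.
move=> om hU hV hUV.
set A := Ex (fun w => U w ^+ 2); set B := Ex (fun w => V w ^+ 2).
set th := Ex (fun w => U w * V w).
have A0 : 0 <= A by apply: Rintegral_ge0 => w _; exact: sqr_ge0.
have B0 : 0 <= B by apply: Rintegral_ge0 => w _; exact: sqr_ge0.
have sq a : Ex (fun w => (a * U w + 1 * V w) ^+ 2) = A * a ^+ 2 + 2 * th * a + B.
  have := gaussian_moment_expansion a 1; rewrite !big_ord_recl big_ord0/= => ->.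
  have -> : Ex (fun w => U w ^+ (2 - 0) * V w ^+ 0) = A.
    by apply: eq_Rintegral => w _; rewrite expr0 mulr1.
  have -> : Ex (fun w => U w ^+ (2 - 1) * V w ^+ 1) = th.
    by apply: eq_Rintegral => w _; rewrite !expr1.
  have -> : Ex (fun w => U w ^+ (2 - 2) * V w ^+ 2) = B.
    by apply: eq_Rintegral => w _; rewrite expr0 mul1r.
  rewrite addr0 -[1.*2]/2%N /bump/= -[(2 - 0)%N]/2%N -[(2 - 1)%N]/1%N.
  by rewrite -[(2 - 2)%N]/0%N bin0 bin1 binn; ring.
pose mom i := Ex (fun w => U w ^+ i * V w ^+ (m.*2 - i)).
pose p := \poly_(i < (m.*2).+1) (mom i *+ 'C(m.*2, i)).
pose q := gauss_const m *: (A *: 'X^2 + (2 * th) *: 'X + B%:P) ^+ m : {poly R}.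
have pq : p = q.
  apply: poly_eq_of_horner => a.
  have [g E] := gUV a 1; have [_ e] := gaussian_even_moment m (m1 a 1) g E.
  transitivity (Ex (fun w => (a * U w + 1 * V w) ^+ m.*2)).
    rewrite gaussian_moment_expansion horner_poly (reindex_inj rev_ord_inj)/=.
    apply: eq_bigr => i _; have im := leq_ord i.
    by rewrite subSS /mom subKn// bin_sub// mulrC mulrnAr.
  etransitivity; first exact: e.
  rewrite -/(Ex (fun w => (a * U w + 1 * V w) ^+ 2)) sq.
  by rewrite /q hornerZ horner_exp !hornerE.
have : q`_m = mom m *+ 'C(m.*2, m).
  by rewrite -pq coef_poly ltnS -addnn leq_addl.
have -> : mom m = Ex (fun w => U w ^+ m * V w ^+ m).
  by rewrite /mom -addnn addnK.
rewrite coefZ; set x := Ex _ => qm.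
have c0 : 0 <= gauss_const m :> R by exact: gauss_const_ge0.
apply: (@le_trans _ _ `|x *+ 'C(m.*2, m)|).
  by rewrite normrMn -mulr_natl ler_peMl// ler1n bin_gt0 -addnn leq_addl.
rewrite -qm normrM (ger0_norm c0) -2!mulrA; apply: ler_wpM2l => //; rewrite mulrA.
by apply: coef_quadratic_power_le => //; apply/andP; split.
Qed.

End bivariate_gaussian.
(** * Second moment of an integral of a process *)

Section product_sigma_finite.
Context {R : realType} d1 d2 (T1 : measurableType d1) (T2 : measurableType d2).
Variables (m1 : {sigma_finite_measure set T1 -> \bar R})
  (m2 : {sigma_finite_measure set T2 -> \bar R}).
Local Open Scope ereal_scope.

Lemma product_measure1_sigma_finite : sigma_finite [set: T1 * T2] (m1 \x m2).
Proof.
have /sigma_finiteP[F [FT ndF Foo]] := sigma_finiteT m1.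
have /sigma_finiteP[G [GT ndG Goo]] := sigma_finiteT m2.
exists (fun n => F n `*` G n) => [|n].
  apply/seteqP; split => // -[x y] _.
  have [[i _ Fx] [j _ Gy]] : (\bigcup_i F i) x /\ (\bigcup_i G i) y.
    by rewrite -FT -GT.
  exists (maxn i j) => //; split => /=.
  - by move: x Fx; exact/subsetPset/ndF/leq_maxl.
  - by move: y Gy; exact/subsetPset/ndG/leq_maxr.
have [[? ?] [? ?]] := (Foo n, Goo n); split; first exact: measurableX.
by rewrite product_measure1E// lte_mul_pinfty// ge0_fin_numE.
Qed.


(** Packaged so that Fubini's theorem can be iterated over three factors. *)
Definition product_sigma_finite_measure :
    {sigma_finite_measure set (T1 * T2)%type -> \bar R} :=
  HB.pack (m1 \x m2) (@Measure_isSigmaFinite.Build _ _ _ (m1 \x m2)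
    product_measure1_sigma_finite).
End product_sigma_finite.

Lemma integrable_indic_lty {R : realType} d (S : measurableType d)
    (nu : {measure set S -> \bar R}) (A : set S) :
  measurable A -> (nu A < +oo)%E -> nu.-integrable [set: S] (EFin \o \1_A).
Proof.
move=> mA Afin; apply/integrableP; split; first exact/measurable_EFinP.
under eq_integral do rewrite gee0_abs ?lee_fin//.
by rewrite integral_indic// setIT.
Qed.

Section fubini_bounds.
Context {R : realType} dZ (Z : measurableType dZ) dO (Omega : measurableType dO).
Variables (N : {sigma_finite_measure set Z -> \bar R}) (P : probability Omega R).
Variables (F : Z * Omega -> R) (D : set Z) (M : R).
Local Open Scope ereal_scope.
Hypotheses (mF : measurable_fun [set: Z * Omega] F) (mD : measurable D)
  (Dfin : N D < +oo) (M0 : (0 <= M)%R)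
  (FM : forall z, \int[P]_w `|(F (z, w))%:E| <= (M * \1_D z)%:E).

Lemma uniformly_integrable_prod :
  (N \x P).-integrable [set: Z * Omega] (EFin \o F).
Proof.
apply/integrable12ltyP; first exact/measurable_EFinP.
apply: (@le_lt_trans _ _ (\int[N]_z (M * \1_D z)%:E)).
  apply: ge0_le_integral => //.
  - by move=> z _; apply: integral_ge0.
  - apply: (measurable_fun_fubini_tonelli_F (abse \o (EFin \o F))).
      by apply: measurableT_comp => //; exact/measurable_EFinP.
    by move=> x; exact: abse_ge0.
  - by apply/measurable_EFinP; apply: measurable_funM => //; exact: measurable_indic.
  - by move=> z _; exact: FM.
under eq_integral do rewrite EFinM.
rewrite integralZl//; last exact: integrable_indic_lty.
by rewrite integral_indic// setIT lte_mul_pinfty.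
Qed.

Lemma le_iterated_integral (Phi : Z -> \bar R) :
  measurable_fun D Phi ->
  (forall z, D z -> `|\int[P]_w (F (z, w))%:E| <= Phi z) ->
  \int[P]_w \int[N]_z (F (z, w))%:E <= \int[N]_(z in D) Phi z.
Proof.
move=> mPhi hPhi; have iF := uniformly_integrable_prod.
rewrite -(Fubini iF); apply: le_trans (lee_abs _) _.
have mFF := measurable_fubini_F iF.
apply: le_trans (le_abse_integral _ measurableT mFF) _.
rewrite [leRHS]integral_mkcond; apply: ge0_le_integral => //.
- exact: measurableT_comp.
- exact/(measurable_restrictT _ _).1.
- move=> z _; rewrite patchE /fubini_F/=; case: ifPn.
    by rewrite inE => Dz; exact: hPhi.
  rewrite notin_setE => Dz.
  apply: le_trans (le_abse_integral _ measurableT _) _.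
    by apply/measurable_EFinP; exact: (measurableT_comp mF (pair1_measurable z)).
  by apply: le_trans (FM z) _; rewrite indicE memNset// mulr0.
Qed.

End fubini_bounds.

Section second_moment.
Context {R : realType} dS (S : measurableType dS) dO (Omega : measurableType dO).
Variables (nu : {sigma_finite_measure set S -> \bar R})
  (P : probability Omega R).
Local Open Scope ereal_scope.

(** The square of the integral is the double integral of [h (s, w) h (t, w)],
    and Fubini's theorem over [S * S] and [Omega] takes the expectation inside.
    The uniform bound [M] on the second moments provides the integrability. *)
Lemma second_moment_integral_le (h : S * Omega -> R) (D : set S) (M : R)
    (Phi : S * S -> \bar R) :
  measurable_fun [set: S * Omega] h -> measurable D -> nu D < +oo -> (0 <= M)%R ->
  (forall s, D s -> \int[P]_w (h (s, w) ^+ 2)%:E <= M%:E) ->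
  measurable_fun (D `*` D) Phi ->
  (forall s t, D s -> D t ->
    `|\int[P]_w (h (s, w) * h (t, w))%:E| <= Phi (s, t)) ->
  measurable_fun [set: Omega] (fun w => (\int[nu]_(s in D) h (s, w))%R) /\
  \int[P]_w ((\int[nu]_(s in D) h (s, w)) ^+ 2)%:E <=
    \int[nu \x nu]_(p in D `*` D) Phi p.
Proof.
move=> mh mD Dfin M0 hM mPhi hPhi.
pose g (q : S * Omega) : R := (\1_D q.1 * h q)%R.
have m1D : measurable_fun [set: S] (\1_D : S -> R) by exact: measurable_indic.
have mg : measurable_fun [set: S * Omega] g.
  by apply: measurable_funM => //; exact: (measurableT_comp m1D measurable_fst).
have mgs s : measurable_fun [set: Omega] (fun w => g (s, w)).
  exact: (measurableT_comp mg (pair1_measurable s)).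
have gD s w : D s -> g (s, w) = h (s, w).
  by move=> Ds; rewrite /g indicE mem_set// mul1r.
have gN s w : ~ D s -> g (s, w) = 0%R.
  by move=> Ds; rewrite /g indicE memNset// mul0r.
have gM s : \int[P]_w (g (s, w) ^+ 2)%:E <= (M * \1_D s)%:E.
  have [Ds|Ds] := pselect (D s).
    rewrite indicE mem_set// mulr1; apply: le_trans (hM _ Ds).
    by under eq_integral do rewrite gD//.
  rewrite indicE memNset// mulr0.
  by under eq_integral do rewrite gN// expr0n/=; rewrite integral0.
(* by |x| <= 1 + x^2, the uniform bound on second moments suffices *)
have ig : (nu \x P).-integrable [set: S * Omega] (EFin \o g).
  have M1 : (0 <= 1 + M)%R by rewrite addr_ge0.
  apply: (uniformly_integrable_prod mg mD Dfin M1) => s.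
  have [Ds|Ds] := pselect (D s); last first.
    under eq_integral do rewrite /= gN// normr0.
    by rewrite integral0 indicE memNset// mulr0.
  rewrite indicE mem_set// mulr1.
  apply: (@le_trans _ _ (\int[P]_w (1%:E + (g (s, w) ^+ 2)%:E))).
    apply: ge0_le_integral => //.
    + by apply: measurableT_comp => //; exact/measurable_EFinP.
    + apply: emeasurable_funD => //; apply/measurable_EFinP.
      exact: measurable_funX.
    + move=> w _ /=; rewrite lee_fin; have := sqr_ge0 (`|g (s, w)| - 1)%R.
      by rewrite sqrrB1 real_normK ?num_real//; have := normr_ge0 (g (s, w)); lra.
  rewrite ge0_integralD//; last 2 first.
  + by move=> w _; rewrite lee_fin sqr_ge0.
  + by apply/measurable_EFinP; exact: measurable_funX.
  rewrite integral_cst//= probability_setT mule1 EFinD leeD2l//.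
  by apply: le_trans (gM s) _; rewrite indicE mem_set// mulr1.
pose F (q : (S * S) * Omega) : R := (g (q.1.1, q.2) * g (q.1.2, q.2))%R.
have mF : measurable_fun [set: (S * S) * Omega] F.
  apply: measurable_funM.
  - apply: (measurableT_comp mg); apply: measurable_fun_pair => //.
    exact: (measurableT_comp measurable_fst measurable_fst).
  - apply: (measurableT_comp mg); apply: measurable_fun_pair => //.
    exact: (measurableT_comp measurable_snd measurable_fst).
have mDD : measurable (D `*` D) by exact: measurableX.
have DDfin : (nu \x nu) (D `*` D) < +oo.
  by rewrite product_measure1E// lte_mul_pinfty// ge0_fin_numE.
have FM z : \int[P]_w `|(F (z, w))%:E| <= (M * \1_(D `*` D) z)%:E.
  case: z => s t; have [[/= Ds Dt]|Dst] := pselect ((D `*` D) (s, t)); last first.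
    under eq_integral => w _.
      have -> : F (s, t, w) = 0%R.
        have [Ds|Ds] := pselect (D s); last by rewrite /F/= gN// mul0r.
        have [Dt|Dt] := pselect (D t); first by case: Dst.
        by rewrite /F/= [g (t, _)]gN// mulr0.
      rewrite abse0; over.
    by rewrite integral0 indicE memNset// mulr0.
  rewrite indicE mem_set// mulr1.
  apply: (@le_trans _ _ (\int[P]_w (2^-1%:E * ((g (s, w) ^+ 2)%:E + (g (t, w) ^+ 2)%:E)))).
    apply: ge0_le_integral => //.
    + apply/measurable_EFinP; apply: measurableT_comp => //.
      exact: (measurableT_comp mF (pair1_measurable (s, t))).
    + apply: emeasurable_funM => //; apply: emeasurable_funD;
        by apply/measurable_EFinP; exact: measurable_funX.
    + move=> w _ /=; rewrite -EFinD -EFinM lee_fin /F/= normrM.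
      have := sqr_ge0 (`|g (s, w)| - `|g (t, w)|)%R.
      by rewrite sqrrB !real_normK ?num_real//; lra.
  rewrite ge0_integralZl_EFin ?invr_ge0//; last 2 first.
  + by move=> w _; rewrite -EFinD lee_fin addr_ge0 ?sqr_ge0.
  + by apply: emeasurable_funD; apply/measurable_EFinP; exact: measurable_funX.
  rewrite ge0_integralD//; try by move=> w _; rewrite lee_fin sqr_ge0.
  + have -> : M%:E = 2^-1%:E * (M%:E + M%:E).
      by rewrite -EFinD -EFinM; congr EFin; field.
    apply: lee_wpmul2l; first by rewrite lee_fin invr_ge0.
    by apply: leeD; [have := gM s|have := gM t]; rewrite indicE mem_set// mulr1.
  + by apply/measurable_EFinP; exact: measurable_funX.
  + by apply/measurable_EFinP; exact: measurable_funX.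
have iF := @uniformly_integrable_prod R _ (S * S)%type _ Omega
  (product_sigma_finite_measure nu nu) P F _ M
  mF mDD DDfin M0 FM.
have Dint w : (\int[nu]_(s in D) h (s, w) = \int[nu]_s g (s, w))%R.
  rewrite Rintegral_mkcond; apply: eq_Rintegral => s _; rewrite patchE /g indicE.
  by case: (s \in D); rewrite ?mul1r ?mul0r.
have mI : measurable_fun [set: Omega] (fun w => (\int[nu]_s g (s, w))%R).
  by apply: measurableT_comp => //; exact: (measurable_fubini_G ig).
have mI' : measurable_fun [set: Omega] (fun w => (\int[nu]_(s in D) h (s, w))%R).
  by under eq_fun do rewrite Dint.
split=> //; have mG := measurable_fubini_G iF.
have aeF := ae_integrable2 iF.
have -> : \int[P]_w ((\int[nu]_(s in D) h (s, w)) ^+ 2)%:E =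
    \int[P]_w fubini_G (product_sigma_finite_measure nu nu) (EFin \o F) w.
  apply: (ae_eq_integral _ _ measurableT _ mG).
  - by apply/measurable_EFinP; exact: measurable_funX.
  - apply: filterS2 (ae_integrable2 ig) aeF => w ig_w iF_w _.
    have iF_w' : (nu \x nu).-integrable [set: S * S]
        (fun p => (EFin \o F) (p, w)) by exact iF_w.
    transitivity (\int[nu]_s \int[nu]_t (g (s, w) * g (t, w))%:E); last first.
      exact: (integral12_prod_meas1 iF_w').
    transitivity (\int[nu]_s ((\int[nu]_t g (t, w))%:E * (g (s, w))%:E)).
      rewrite integralZl// Dint expr2 EFinM; congr (_ * _).
      by rewrite /Rintegral fineK// (integrable_fin_num _ ig_w).
    apply: eq_integral => s _; under [RHS]eq_integral do rewrite EFinM.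
    rewrite integralZl// muleC; congr (_ * _).
    by rewrite /Rintegral fineK// (integrable_fin_num _ ig_w).
apply: (@le_iterated_integral R _ (S * S)%type _ Omega
  (product_sigma_finite_measure nu nu) P F _ M
  mF mDD DDfin M0 FM) => // -[s t] [/= Ds Dt].
apply: le_trans (hPhi _ _ Ds Dt).
by under eq_integral do rewrite /F/= !gD//.
Qed.

End second_moment.
(** Tonelli's theorem for the indicator of [A]. *)
Lemma integral_xsection_le {R : realType} d1 d2 (T1 : measurableType d1)
    (T2 : measurableType d2) (m1 : {sigma_finite_measure set T1 -> \bar R})
    (m2 : {sigma_finite_measure set T2 -> \bar R}) (A : set (T1 * T2))
    (B : set T2) (c : R) :
  measurable A -> measurable B -> 0 <= c ->
  (forall y, (m1 (ysection A y) <= (c * \1_B y)%:E)%E) ->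
  (\int[m1]_x m2 (xsection A x) <= c%:E * m2 B)%E.
Proof.
move=> mA mB c0 hc.
rewrite -[leLHS]/(\int[m1]_x (m2 \o xsection A) x)%E -indic_fubini_tonelli_FE//.
rewrite (indic_fubini_tonelli m1 m2 mA) indic_fubini_tonelli_GE//.
apply: (@le_trans _ _ (\int[m2]_y (c%:E * (\1_B y)%:E))%E).
  apply: ge0_le_integral => //.
  - have := measurable_fun_ysection m1 mA; exact.
  - apply: emeasurable_funM => //.
    exact/measurable_EFinP/measurable_indic.
  - by move=> y _; rewrite -EFinM; exact: hc.
rewrite ge0_integralZl_EFin//; last exact/measurable_EFinP/measurable_indic.
by rewrite integral_indic// setIT.
Qed.

(** * Increments of a Gaussian process *)

Section linear_combinations.
Context {R : realType} d (Omega : measurableType d) (P : probability Omega R).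

Variables (Tmax : R) (X : R -> {RV P >-> R}).
Hypothesis X_gauss : centered_gaussian_process Tmax X.

Lemma integrable_of_square (Y : Omega -> R) : measurable_fun [set: Omega] Y ->
  P.-integrable [set: Omega] (EFin \o (fun w => Y w ^+ 2)) ->
  P.-integrable [set: Omega] (EFin \o Y).
Proof.
move=> mY iY.
have i1 : P.-integrable [set: Omega] (EFin \o (fun w => 1 + Y w ^+ 2)).
  have i0 : P.-integrable [set: Omega] (EFin \o cst 1).
    exact: finite_measure_integrable_cst.
  by have := integrableD measurableT i0 iY.
apply: le_integrable i1 => //; first exact/measurable_EFinP.
move=> w _ /=; rewrite lee_fin [leRHS]ger0_norm ?addr_ge0 ?sqr_ge0//.
have := sqr_ge0 (`|Y w| - 1).
by rewrite sqrrB1 real_normK ?num_real//; have := normr_ge0 (Y w); lra.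
Qed.

Lemma process_gaussian_integrable t : t \in `[0, Tmax] ->
  P.-integrable [set: Omega] (EFin \o X t).
Proof.
move=> ht; have [EX gX] := X_gauss.
have eX : (fun w => \sum_(i < 1) 1 * X t w) = X t.
  by apply/funext => w; rewrite big_ord1 mul1r.
have g : gaussian P (X t).
  by have := gX 1%N (fun=> t) (fun=> 1) (fun=> ht); rewrite eX.
apply: integrable_of_square => //.
by have [] := gaussian_even_moment 1 _ g (EX _ ht).
Qed.

Lemma linear_combination_centered n (t a : 'I_n -> R) :
  (forall i, t i \in `[0, Tmax]) ->
  gaussian P (fun w => \sum_(i < n) a i * X (t i) w) /\
  ('E_P[fun w => (\sum_(i < n) a i * X (t i) w)%R] = 0)%E.
Proof.
move=> ht; have [EX gX] := X_gauss; split; first exact: gX.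
have ia i : P.-integrable [set: Omega] (EFin \o (fun w => a i * X (t i) w)).
  by have := integrableZl measurableT (a i) (process_gaussian_integrable (ht i)).
rewrite unlock; under eq_integral do rewrite -sumEFin.
rewrite (integral_sum measurableT ia) big1// => i _.
under eq_integral do rewrite /= EFinM.
rewrite integralZl//; last exact: process_gaussian_integrable.
by have := EX _ (ht i); rewrite unlock => ->; rewrite mule0.
Qed.

Definition increment a b (w : Omega) := X b w - X a w.

Lemma measurable_increment a b : measurable_fun [set: Omega] (increment a b).
Proof. exact: measurable_funB. Qed.

Lemma increment_pair a b a' b' : a \in `[0, Tmax] -> b \in `[0, Tmax] ->
  a' \in `[0, Tmax] -> b' \in `[0, Tmax] ->
  centered_gaussian_pair P (increment a b) (increment a' b').
Proof.
move=> ha hb ha' hb' x y.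
pose t (i : 'I_4) := nth 0 [:: a; b; a'; b'] i.
pose c (i : 'I_4) := nth 0 [:: - x; x; - y; y] i.
have ht i : t i \in `[0, Tmax].
  by rewrite /t; case: i => [[|[|[|[|]]]]].
have := @linear_combination_centered 4 t c ht.
suff -> : (fun w => \sum_(i < 4) c i * X (t i) w) =
    (fun w => x * increment a b w + y * increment a' b' w) by [].
by apply/funext => w; rewrite !big_ord_recl big_ord0 /c /t /increment/=; ring.
Qed.

Local Notation Ex f := (\int[P]_w (f w)).

Lemma delta2E a b : delta2 X a b = Ex (fun w => increment a b w ^+ 2).
Proof. by rewrite /delta2 unlock. Qed.

Lemma delta2_ge0 a b : 0 <= delta2 X a b.
Proof. by rewrite delta2E; apply: Rintegral_ge0 => w _; exact: sqr_ge0. Qed.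

Lemma delta2C a b : delta2 X a b = delta2 X b a.
Proof.
rewrite !delta2E; apply: eq_Rintegral => w _.
by rewrite /increment -sqrrN opprB.
Qed.

Lemma delta2_diag a : delta2 X a a = 0.
Proof.
rewrite delta2E /Rintegral; under eq_integral do rewrite /increment subrr expr0n/=.
by rewrite integral0.
Qed.

Section four_times.
Variables a b a' b' : R.
Hypotheses (ha : a \in `[0, Tmax]) (hb : b \in `[0, Tmax])
  (ha' : a' \in `[0, Tmax]) (hb' : b' \in `[0, Tmax]).

Lemma increment_product_integrable : P.-integrable [set: Omega]
  (EFin \o (fun w => increment a b w * increment a' b' w)).
Proof.
have := gaussian_monomial_integrable (measurable_increment a b)
  (measurable_increment a' b') (increment_pair ha hb ha' hb') (erefl : (1 + 1 = 1.*2)%N).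
by [].
Qed.

Lemma increment_sqr_integrable :
  P.-integrable [set: Omega] (EFin \o (fun w => increment a b w ^+ 2)).
Proof.
have [g E] := increment_pair ha hb ha' hb' 1 0.
have := gaussian_monomial_integrable (measurable_increment a b)
  (measurable_increment a' b') (increment_pair ha hb ha' hb') (erefl : (2 + 0 = 1.*2)%N).
by apply: eq_integrable => // w _; rewrite /= expr0 mulr1.
Qed.

End four_times.

Lemma increment_covariance_le (a b a' b' D : R) :
  a \in `[0, Tmax] -> b \in `[0, Tmax] ->
  a' \in `[0, Tmax] -> b' \in `[0, Tmax] ->
  delta2 X a b <= D -> delta2 X a' b' <= D ->
  `|Ex (fun w => increment a b w * increment a' b' w)| <= D.
Proof.
move=> ha hb ha' hb'; rewrite !delta2E => hD hD'.
have i1 := increment_sqr_integrable ha hb ha' hb'.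
have i2 := increment_sqr_integrable ha' hb' ha hb.
have i12 := increment_product_integrable ha hb ha' hb'.
have [ik kE] := Rintegral_linear4 2^-1 2^-1 0 0 measurableT i1 i2 i1 i2.
apply: le_trans (le_normr_Rintegral measurableT i12) _.
apply: (@le_trans _ _ (2^-1 * D + 2^-1 * D + 0 * D + 0 * D)); last by lra.
apply: (le_trans (le_Rintegral _ _ ik _)) => //.
- exact: integrable_norm.
- move=> w _; rewrite /= normrM.
  have := sqr_ge0 (`|increment a b w| - `|increment a' b' w|).
  by rewrite sqrrB !real_normK ?num_real//; lra.
- by rewrite kE !mul0r !addr0 lerD// ler_wpM2l// invr_ge0.
Qed.

(** The pointwise identity behind it is
    [(x2-y2)^2 - (x2-y1)^2 - (x1-y2)^2 + (x1-y1)^2 = -2 (x2-x1)(y2-y1)]. *)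
Lemma delta2_rectangle (s1 s2 t1 t2 : R) :
  s1 \in `[0, Tmax] -> s2 \in `[0, Tmax] ->
  t1 \in `[0, Tmax] -> t2 \in `[0, Tmax] ->
  delta2 X s2 t2 - delta2 X s2 t1 - delta2 X s1 t2 + delta2 X s1 t1 =
  - 2 * Ex (fun w => increment s1 s2 w * increment t1 t2 w).
Proof.
move=> hs1 hs2 ht1 ht2; rewrite !delta2E.
have i22 := increment_sqr_integrable hs2 ht2 hs1 ht1.
have i21 := increment_sqr_integrable hs2 ht1 hs1 ht1.
have i12 := increment_sqr_integrable hs1 ht2 hs1 ht1.
have i11 := increment_sqr_integrable hs1 ht1 hs1 ht1.
have [_] := Rintegral_linear4 1 (-1) (-1) 1 measurableT i22 i21 i12 i11.
rewrite !mul1r !mulN1r => <-.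
rewrite -RintegralZl//; last exact: increment_product_integrable.
by apply: eq_Rintegral => w _; rewrite /increment; ring.
Qed.

(** With [x] the difference of the two increments and [a] the increment over
    [s, t], the square changes by [x^2 + 2 a x], and
    [|2 a x| <= x^2 / lambda + lambda a^2]; the parameter [lambda] is later
    chosen small, before [kappa]. *)
Lemma delta2_perturbation (s t u v kappa lambda : R) :
  s \in `[0, Tmax] -> t \in `[0, Tmax] ->
  u \in `[0, Tmax] -> v \in `[0, Tmax] -> 0 < lambda ->
  delta2 X s u <= kappa -> delta2 X t v <= kappa ->
  `|delta2 X u v - delta2 X s t| <=
    4 * (1 + lambda^-1) * kappa + lambda * delta2 X s t.
Proof.
move=> hs ht hu hv l0; rewrite !delta2E => hsu htv.
have iuv := increment_sqr_integrable hu hv hu hv.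
have ist := increment_sqr_integrable hs ht hu hv.
have isu := increment_sqr_integrable hs hu hu hv.
have itv := increment_sqr_integrable ht hv hu hv.
have [id dE] := Rintegral_linear4 1 (-1) 0 0 measurableT iuv ist isu itv.
pose L := 2 * (1 + lambda^-1).
have L0 : 0 <= L by rewrite mulr_ge0// addr_ge0// invr_ge0 ltW.
have [ib bE] := Rintegral_linear4 L L lambda 0 measurableT isu itv ist iuv.
move: dE; rewrite mul1r mulN1r !mul0r !addr0 => <-.
apply: le_trans (le_normr_Rintegral measurableT id) _.
apply: (le_trans (le_Rintegral _ _ ib _)) => //.
- exact: integrable_norm.
- move=> w _; rewrite /= !mul0r !addr0 mul1r mulN1r.
  set x := X v w - X t w - (X u w - X s w).
  set a := increment s t w.
  have -> : increment u v w ^+ 2 - a ^+ 2 = x ^+ 2 + 2 * (a * x).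
    by rewrite /a /x /increment; ring.
  have h1 : x ^+ 2 <= 2 * increment s u w ^+ 2 + 2 * increment t v w ^+ 2.
    have := sqr_ge0 (X v w - X t w + (X u w - X s w)).
    by rewrite /x /increment; lra.
  have h2 : `|2 * (a * x)| <= lambda^-1 * x ^+ 2 + lambda * a ^+ 2.
    have li : lambda^-1 * lambda = 1 by rewrite mulVf// gt_eqF.
    have lV : 0 <= lambda^-1 by rewrite invr_ge0 ltW.
    have e1 : lambda^-1 * (x - lambda * a) ^+ 2 =
        lambda^-1 * x ^+ 2 + lambda * a ^+ 2 - 2 * (a * x).
      by field; rewrite gt_eqF.
    have e2 : lambda^-1 * (x + lambda * a) ^+ 2 =
        lambda^-1 * x ^+ 2 + lambda * a ^+ 2 + 2 * (a * x).
      by field; rewrite gt_eqF.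
    have p1 : 0 <= lambda^-1 * (x - lambda * a) ^+ 2 by rewrite mulr_ge0 ?sqr_ge0.
    have p2 : 0 <= lambda^-1 * (x + lambda * a) ^+ 2 by rewrite mulr_ge0 ?sqr_ge0.
    by rewrite ler_norml; apply/andP; split; lra.
  apply: le_trans (ler_normD _ _) _; rewrite (ger0_norm (sqr_ge0 x)).
  apply: le_trans (lerD (lexx _) h2) _; rewrite addrA lerD2r /L.
  have -> : x ^+ 2 + lambda^-1 * x ^+ 2 = (1 + lambda^-1) * x ^+ 2 by ring.
  have -> (p q : R) : 2 * (1 + lambda^-1) * p + 2 * (1 + lambda^-1) * q =
    (1 + lambda^-1) * (2 * p + 2 * q) by ring.
  by rewrite ler_wpM2l// addr_ge0// invr_ge0 ltW.
- rewrite bE mul0r addr0 lerD2r.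
  have -> : 4 * (1 + lambda^-1) * kappa = L * kappa + L * kappa by rewrite /L; ring.
  by rewrite lerD// ler_wpM2l.
Qed.

End linear_combinations.
Lemma delta2_le_of_delta_sup {R : realType} d (Omega : measurableType d)
    (P : probability Omega R) (X : R -> {RV P >-> R}) (T r y s : R) :
  0 <= y -> (delta_sup X T r <= y%:E)%E -> s \in `[0, T] ->
  delta2 X s (s + r) <= y ^+ 2.
Proof.
move=> y0 hy hs.
have f0 := delta2_ge0 X s (s + r).
have h1 : ((delta2 X s (s + r))%:E <= delta2_sup X T r)%E.
  by apply: ereal_sup_ubound; exists s.
have h2 : (((delta2 X s (s + r))%:E `^ 2^-1)%E <= y%:E)%E.
  apply: le_trans hy; rewrite /delta_sup; apply: gt0_ler_poweR => //;
    rewrite ?invr_ge0// in_itv/= leey andbT ?lee_fin//.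
  by apply: le_trans h1; rewrite lee_fin.
move: h2; rewrite poweR_EFin lee_fin powR12_sqrt// => h2.
by rewrite -(sqr_sqrtr f0) lerXn2r ?nnegrE// sqrtr_ge0.
Qed.

(** * Windows around the off-diagonal rectangles *)

Section windows.
Context {R : realType}.
Local Notation leb := (@lebesgue_measure R).
Local Notation leb2 := (product_sigma_finite_measure
  (@lebesgue_measure R) (@lebesgue_measure R)).

Lemma lebesgue_measure_cc (a b : R) : a <= b -> leb `[a, b] = (b - a)%:E.
Proof.
rewrite le_eqVlt => /predU1P[->|ab].
  by rewrite set_itv1 lebesgue_measure_set1 subrr.
by rewrite lebesgue_measure_itv/= lte_fin ab EFinB.
Qed.

Lemma leb2_box (a b a' b' : R) : a <= b -> a' <= b' ->
  leb2 (`[a, b] `*` `[a', b']) = ((b - a) * (b' - a'))%:E.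
Proof.
move=> ab ab'; transitivity (leb `[a, b] * leb `[a', b'])%E.
  by apply: product_measure1E; exact (measurable_itv _).
by rewrite !lebesgue_measure_cc// -EFinM.
Qed.

Lemma measurable_OD (T e : R) : measurable (OD T e).
Proof.
have -> : OD T e = [set p | 0 <= p.1] `&` [set p | 0 <= p.2 - e - p.1] `&`
    [set p : R * R | 0 <= T - (p.2 - e)].
  apply/seteqP; split => p; rewrite /OD/= !subr_ge0; first by case.
  by move=> [[]].
apply: measurableI; first apply: measurableI; apply: measurable_ge0 => //;
  by do ?[exact: measurable_fst|exact: measurable_snd|apply: measurable_funB].
Qed.

(** The pairs of a point [(s, t)] and a point [(u, v)] of the off-diagonal
    simplex that lies in the enlarged rectangle of [(s, t)] or of [(t, s)]. *)
Definition window (T e : R) : set ((R * R) * (R * R)) :=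
  (snd @^-1` OD T e) `&`
  ((fun q => (q.2.1 - q.1.1, q.2.2 - q.1.2)) @^-1` (`[- e, 2 * e] `*` `[- e, 2 * e]) `|`
   (fun q => (q.2.1 - q.1.2, q.2.2 - q.1.1)) @^-1` (`[- e, 2 * e] `*` `[- e, 2 * e])).

Lemma measurable_window (T e : R) : measurable (window T e).
Proof.
have mc : measurable (`[- e, 2 * e] `*` `[- e, 2 * e] : set (R * R)).
  by apply: measurableX; exact: measurable_itv.
have m11 : measurable_fun [set: (R * R) * (R * R)] (fun q => q.1.1).
  exact: (measurableT_comp measurable_fst measurable_fst).
have m12 : measurable_fun [set: (R * R) * (R * R)] (fun q => q.1.2).
  exact: (measurableT_comp measurable_snd measurable_fst).
have m21 : measurable_fun [set: (R * R) * (R * R)] (fun q => q.2.1).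
  exact: (measurableT_comp measurable_fst measurable_snd).
have m22 : measurable_fun [set: (R * R) * (R * R)] (fun q => q.2.2).
  exact: (measurableT_comp measurable_snd measurable_snd).
apply: measurableI.
  rewrite -[X in measurable X]setTI.
  exact: (@measurable_snd _ _ _ _ measurableT _ (measurable_OD T e)).
apply: measurableU; rewrite -[X in measurable X]setTI.
- have mf : measurable_fun [set: (R * R) * (R * R)]
    (fun q => (q.2.1 - q.1.1, q.2.2 - q.1.2)).
    by apply: measurable_fun_pair; apply: measurable_funB.
  exact: mf.
- have mf : measurable_fun [set: (R * R) * (R * R)]
    (fun q => (q.2.1 - q.1.2, q.2.2 - q.1.1)).
    by apply: measurable_fun_pair; apply: measurable_funB.
  exact: mf.
Qed.

(** For fixed [(u, v)] the points [(s, t)] form two squares of side [3 e]. *)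
Lemma integral_window_le (nu : {sigma_finite_measure set (R * R)%type -> \bar R})
    (T e : R) : 0 < e ->
  (\int[leb2]_p nu (xsection (window T e) p) <= (18 * e ^+ 2)%:E * nu (OD T e))%E.
Proof.
move=> e0; apply: (integral_xsection_le (m1 := leb2)).
- exact (measurable_window T e).
- exact: measurable_OD.
- by rewrite mulr_ge0 ?sqr_ge0.
move=> [u v]; have [uvOD|uvOD] := pselect (OD T e (u, v)); last first.
  have -> : ysection (window T e) (u, v) = set0.
    by apply/seteqP; split => // p; rewrite /ysection/= inE => -[/uvOD].
  by rewrite measure0 indicE memNset// mulr0.
rewrite indicE mem_set// mulr1.
pose B1 : set (R * R) := `[u - 2 * e, u + e] `*` `[v - 2 * e, v + e].
pose B2 : set (R * R) := `[v - 2 * e, v + e] `*` `[u - 2 * e, u + e].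
have mB1 : @measurable _ (measurableTypeR R * measurableTypeR R)%type B1.
  by apply: measurableX; exact (measurable_itv _).
have mB2 : @measurable _ (measurableTypeR R * measurableTypeR R)%type B2.
  by apply: measurableX; exact (measurable_itv _).
apply: (@le_trans _ _ (leb2 (B1 `|` B2))).
  apply: le_measure; rewrite ?inE.
  - by apply: measurable_ysection; exact (measurable_window T e).
  - exact: measurableU.
  - move=> [s t]; rewrite /ysection/= inE => -[_ /=].
    rewrite /= !in_itv/= => -[[/andP[? ?] /andP[? ?]]|[/andP[? ?] /andP[? ?]]];
      [left|right]; by split; rewrite /= in_itv/=; apply/andP; split; lra.
apply: (le_trans (measureU2 _ mB1 mB2)).
have b1 : leb2 B1 = (9 * e ^+ 2)%:E.
  by etransitivity; [apply: leb2_box; lra|congr EFin; ring].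
have b2 : leb2 B2 = (9 * e ^+ 2)%:E.
  by etransitivity; [apply: leb2_box; lra|congr EFin; ring].
apply: (@le_trans _ _ ((9 * e ^+ 2)%:E + (9 * e ^+ 2)%:E)%E).
  by apply: leeD; rewrite le_eqVlt; apply/orP; left; apply/eqP; [exact b1|exact b2].
by rewrite -EFinD lee_fin; lra.
Qed.

(** The part of the square where the rectangle of [(s, t)], once enlarged, may
    leave the off-diagonal simplex or the domain of mean-square continuity. *)
Definition strip (T e : R) : set (R * R) :=
  `[0, e] `*` `[0, T] `|` `[0, T] `*` `[0, e] `|`
  `[T - e, T] `*` `[0, T] `|` `[0, T] `*` `[T - e, T] `|`
  [set p | 0 <= p.1 - p.2 + 4 * e] `&` [set p | 0 <= p.2 - p.1 + 4 * e] `&`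
    (snd @^-1` `[0, T]).

Definition far (T e s t : R) := [/\ e < s, s + 4 * e <= t & t < T - e].

Lemma notin_strip (T e s t : R) : s \in `[0, T] -> t \in `[0, T] ->
  ~ strip T e (s, t) -> far T e s t \/ far T e t s.
Proof.
rewrite !in_itv/= => /andP[s0 sT] /andP[t0 tT] nst.
have es : e < s.
  rewrite ltNge; apply/negP => se; apply: nst; do 4 left.
  by split; rewrite /= in_itv/= ?s0 ?t0.
have et : e < t.
  rewrite ltNge; apply/negP => te; apply: nst; do 3 left; right.
  by split; rewrite /= in_itv/= ?s0 ?t0.
have sTe : s < T - e.
  rewrite ltNge; apply/negP => se; apply: nst; do 2 left; right.
  by split; rewrite /= in_itv/= ?se ?t0.
have tTe : t < T - e.
  rewrite ltNge; apply/negP => te; apply: nst; left; right.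
  by split; rewrite /= in_itv/= ?te ?s0.
have [st|st] := leP (s + 4 * e) t; first by left.
have [ts|ts] := leP (t + 4 * e) s; first by right.
exfalso; apply: nst; right; split; last by rewrite /= in_itv/= t0.
by split => /=; lra.
Qed.

Lemma measurable_diagonal_strip (T e : R) :
  measurable ([set p : R * R | 0 <= p.1 - p.2 + 4 * e] `&`
    [set p | 0 <= p.2 - p.1 + 4 * e] `&` (snd @^-1` `[0, T])).
Proof.
apply: measurableI.
  by apply: measurableI; apply: measurable_ge0; apply: measurable_funD => //;
    exact: measurable_funB.
rewrite -[X in measurable X]setTI.
by apply: (@measurable_snd _ _ _ _ measurableT); exact: measurable_itv.
Qed.

Lemma measurable_strip (T e : R) : measurable (strip T e).
Proof.
do 4 (apply: measurableU;
  last by [exact: measurable_diagonal_strip|apply: measurableX; exact: measurable_itv]).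
by apply: measurableX; exact: measurable_itv.
Qed.

Lemma leb2_strip_le (T e : R) : 0 < T -> 0 < e ->
  (leb2 (strip T e) <= (12 * T * e)%:E)%E.
Proof.
move=> T0 e0; have T0' := ltW T0; have e0' := ltW e0.
have mI (a b : R) : measurable (`[a, b] : set (measurableTypeR R)).
  exact (measurable_itv _).
have mX (a b a' b' : R) : @measurable _ (measurableTypeR R * measurableTypeR R)%type
    (`[a, b] `*` `[a', b']) by exact: measurableX.
have m5 : @measurable _ (measurableTypeR R * measurableTypeR R)%type
    ([set p : R * R | 0 <= p.1 - p.2 + 4 * e] `&`
     [set p | 0 <= p.2 - p.1 + 4 * e] `&` (snd @^-1` `[0, T])).
  exact (measurable_diagonal_strip T e).
rewrite /strip; set S5 := _ `&` _ `&` _ in m5 *.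
have h5 : (leb2 S5 <= (8 * e * T)%:E)%E.
  apply: le_trans (@integral_xsection_le _ _ _ _ _ leb leb S5 `[0, T] (8 * e)
    _ _ _ _) _.
  - exact: m5.
  - exact: mI.
  - by rewrite mulr_ge0.
  - move=> y; have [yT|yT] := pselect (`[0, T]%classic y); last first.
      have -> : ysection S5 y = set0.
        by apply/seteqP; split => // x; rewrite /ysection/= inE => -[_] /yT.
      by rewrite measure0 indicE memNset// mulr0.
    rewrite indicE mem_set// mulr1.
    apply: (@le_trans _ _ (leb `[y - 4 * e, y + 4 * e])).
      apply: le_measure; rewrite ?inE.
      + exact: measurable_ysection.
      + exact: mI.
      + move=> x; rewrite /ysection/= inE => -[[/= x1 x2] _].
        by rewrite in_itv/=; apply/andP; split; lra.
    rewrite le_eqVlt; apply/orP; left; apply/eqP.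
    by etransitivity; [apply: lebesgue_measure_cc; lra|congr EFin; ring].
  - apply: (@le_trans _ _ ((8 * e)%:E * T%:E)%E); last by rewrite -EFinM.
    apply: lee_wpmul2l; first by rewrite lee_fin mulr_ge0.
    rewrite le_eqVlt; apply/orP; left; apply/eqP.
    by etransitivity; [apply: lebesgue_measure_cc|rewrite subr0].
have box (a b a' b' : R) : a <= b -> a' <= b' ->
    (leb2 (`[a, b] `*` `[a', b']) <= ((b - a) * (b' - a'))%:E)%E.
  by move=> ab ab'; rewrite le_eqVlt; apply/orP; left; apply/eqP; exact: leb2_box.
have -> : (12 * T * e)%:E = (((e - 0) * (T - 0))%:E + ((T - 0) * (e - 0))%:E +
  ((T - (T - e)) * (T - 0))%:E + ((T - 0) * (T - (T - e)))%:E + (8 * e * T)%:E)%E.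
  by rewrite -!EFinD; congr EFin; ring.
have mU1 := measurableU _ _ (mX 0 e 0 T) (mX 0 T 0 e).
have mU2 := measurableU _ _ mU1 (mX (T - e) T 0 T).
have mU3 := measurableU _ _ mU2 (mX 0 T (T - e) T).
apply: (le_trans (measureU2 _ mU3 m5)); apply: leeD h5.
apply: (le_trans (measureU2 _ mU2 (mX _ _ _ _))); apply: leeD; last first.
  by apply: box; lra.
apply: (le_trans (measureU2 _ mU1 (mX _ _ _ _))); apply: leeD; last first.
  by apply: box; lra.
apply: (le_trans (measureU2 _ (mX _ _ _ _) (mX _ _ _ _))).
by apply: leeD; apply: box.
Qed.

End windows.
Lemma near_at_right0 {R : realType} (Q : R -> Prop) :
  (\forall r \near 0^'+, Q r) <->
  exists2 e : R, 0 < e & forall r, 0 < r -> r < e -> Q r.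
Proof.
split=> [[e /= e0 he]|[e e0 he]].
  exists e => // r r0 re; apply: he => //=.
  by rewrite sub0r normrN gtr0_norm.
exists e => //= r /=; rewrite sub0r normrN => re r0; apply: he => //.
by rewrite -(gtr0_norm r0).
Qed.

Definition enlarged_box {R : realType} (e s t : R) : set (R * R) :=
  `[s - e, s + e + e] `*` `[t - e, t + e + e].

(** * Mean-square continuity and covariances far from the diagonal *)

Section mean_square_modulus.
Context {R : realType} d (Omega : measurableType d) (P : probability Omega R).
Variables (T Tmax : R) (m : nat) (X : R -> {RV P >-> R}).
Hypotheses (TTmax : T <= Tmax) (X_gauss : centered_gaussian_process Tmax X).
Hypothesis delta_o : forall eta : R, 0 < eta -> \forall r \near 0^'+,
  (delta_sup X T r <= (eta * r `^ (2 * m%:R)^-1)%:E)%E.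

Lemma mean_square_modulus (kappa : R) : 0 < kappa ->
  exists2 h : R, 0 < h & forall u v, u \in `[0, T] -> v \in `[0, T] ->
    `|v - u| <= h -> delta2 X u v <= kappa.
Proof.
move=> k0; have sk0 : 0 < Num.sqrt kappa by rewrite sqrtr_gt0.
have /near_at_right0[r0 r0_gt0 hr0] := delta_o sk0.
pose h := Num.min (r0 / 2) 1.
have h_gt0 : 0 < h by rewrite lt_min ltr01 divr_gt0.
have key u r : u \in `[0, T] -> 0 < r -> r <= h -> delta2 X u (u + r) <= kappa.
  move=> hu r_gt0; rewrite le_min => /andP[rr0 r1].
  have rr : r < r0 by lra.
  have pw1 : r `^ (2 * m%:R)^-1 <= 1.
    apply: (@le_trans _ _ (1 `^ (2 * m%:R)^-1)); last by rewrite powR1.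
    by apply: ge0_ler_powR; rewrite ?nnegrE ?invr_ge0 ?mulr_ge0 ?(ltW r_gt0).
  have pw0 : 0 <= r `^ (2 * m%:R)^-1 by exact: powR_ge0.
  have y0 : 0 <= Num.sqrt kappa * r `^ (2 * m%:R)^-1 by rewrite mulr_ge0// ltW.
  apply: le_trans (delta2_le_of_delta_sup y0 (hr0 _ r_gt0 rr) hu) _.
  by rewrite exprMn (sqr_sqrtr (ltW k0)) ler_piMr ?(ltW k0)// exprn_ile1.
exists h => // u v hu hv.
have [uv|vu|->] := ltgtP u v; last by rewrite delta2_diag (ltW k0).
- rewrite gtr0_norm ?subr_gt0// => uvh.
  by have := key u (v - u) hu; rewrite subr_gt0 [u + _]addrC subrK; apply.
- rewrite ltr0_norm ?subr_lt0// opprB => uvh.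
  by rewrite delta2C; have := key v (u - v) hv; rewrite subr_gt0 [v + _]addrC subrK; apply.
Qed.

(** Only times in the open interval qualify: the hypothesis on [delta] says
    nothing about increments that start after [T]. *)
Lemma delta2_continuous (s t e : R) : 0 < s < T -> 0 < t < T -> 0 < e ->
  exists2 h, 0 < h & forall u v, `|u - s| <= h -> `|v - t| <= h ->
    `|delta2 X u v - delta2 X s t| <= e.
Proof.
move=> /andP[s0 sT] /andP[t0 tT] e0.
have f0 := delta2_ge0 X s t.
pose l := e / (2 * (delta2 X s t + 1)).
have l0 : 0 < l by rewrite divr_gt0// mulr_gt0// ltr_wpDl.
have l1 : 0 < 1 + l^-1 by rewrite ltr_wpDr ?invr_ge0// ltW.
pose k := e / (8 * (1 + l^-1)).
have k0 : 0 < k by rewrite divr_gt0// mulr_gt0.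
have [h h0 hh] := mean_square_modulus k0.
exists (Num.min h (Num.min (Num.min s (T - s)) (Num.min t (T - t)))).
  by rewrite !lt_min h0 s0 t0 !subr_gt0 sT tT.
move=> u v; rewrite !le_min => /andP[us /andP[/andP[us1 us2] _]].
move=> /andP[vt /andP[_ /andP[vt1 vt2]]].
rewrite !ler_norml in us1 us2 vt1 vt2; move: us1 us2 vt1 vt2.
move=> /andP[? ?] /andP[? ?] /andP[? ?] /andP[? ?].
have hu : u \in `[0, T] by rewrite in_itv/=; apply/andP; split; lra.
have hv : v \in `[0, T] by rewrite in_itv/=; apply/andP; split; lra.
have hs : s \in `[0, T] by rewrite in_itv/= !ltW.
have ht : t \in `[0, T] by rewrite in_itv/= !ltW.
have inTmax x : x \in `[0, T] -> x \in `[0, Tmax].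
  by rewrite !in_itv/= => /andP[-> /le_trans ->].
apply: le_trans (delta2_perturbation X_gauss (inTmax _ hs) (inTmax _ ht)
  (inTmax _ hu) (inTmax _ hv) l0 (hh _ _ hs hu us) (hh _ _ ht hv vt)) _.
have -> : 4 * (1 + l^-1) * k = e / 2 by rewrite /k; field; rewrite !gt_eqF//; lra.
have : l * (delta2 X s t + 1) = e / 2.
  by rewrite /l; field; rewrite gt_eqF// ltr_wpDl.
move: l0; rewrite mulrDr; lra.
Qed.

Local Notation Ex f := (\int[P]_w (f w)).

Lemma far_covariance_le (mu : signed_measure (R * R)%type R) (e s t : R) :
  mixed_derivative_is (open_square Tmax `\` diagonal) (delta2 X) mu ->
  0 < e -> e <= Tmax - T -> far T e s t ->
  (`|Ex (fun w => increment X s (s + e) w * increment X t (t + e) w)%R|%:E <=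
    abs_measure mu (enlarged_box e s t))%E.
Proof.
move=> dmu e0 eT [es st tT].
have inTmax x : 0 < x -> x < T -> x \in `[0, Tmax].
  by move=> x0 xT; rewrite in_itv/= ltW//=; lra.
have rect : (`|delta2 X (s + e) (t + e) - delta2 X (s + e) t
    - delta2 X s (t + e) + delta2 X s t|%:E <=
    abs_measure mu (enlarged_box e s t))%E.
  apply: (rectangle_increment_le dmu) => //; try lra.
  move=> x y k hx hy k0; apply: delta2_continuous => //.
  - by move: hx; rewrite !inE => /orP[]/eqP->; apply/andP; split; lra.
  - by move: hy; rewrite !inE => /orP[]/eqP->; apply/andP; split; lra.
rewrite (delta2_rectangle X_gauss) in rect; try (apply: inTmax; lra).
apply: le_trans rect; rewrite lee_fin mulNr normrN normrM.
by rewrite (ger0_norm (ler0n R 2)) ler_peMl// ler1n.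
Qed.

Lemma far_window_sub (e s t : R) : 0 < e -> far T e s t ->
  enlarged_box e s t `<=` xsection (window T e) (s, t) /\
  enlarged_box e s t `<=` xsection (window T e) (t, s).
Proof.
move=> e0 [es st tT]; split=> -[u v] [/=]; rewrite !in_itv/=;
  move=> /andP[? ?] /andP[? ?]; rewrite /xsection/= inE; split.
- by split => /=; lra.
- by left; split; rewrite /= in_itv/=; apply/andP; split; lra.
- by split => /=; lra.
- by right; split; rewrite /= in_itv/=; apply/andP; split; lra.
Qed.

End mean_square_modulus.
(** * The second moment for a fixed step *)

Section fixed_step.
Context {R : realType} d (Omega : measurableType d) (P : probability Omega R).
Variables (T Tmax : R) (m : nat) (X : R -> {RV P >-> R})
  (mu : signed_measure (R * R)%type R).
Hypotheses (T_gt0 : 0 < T) (m_odd : odd m)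
  (X_gauss : centered_gaussian_process Tmax X)
  (X_meas : measurable_process Tmax X).
Local Notation leb := (@lebesgue_measure R).
Local Notation leb2 := (product_sigma_finite_measure
  (@lebesgue_measure R) (@lebesgue_measure R)).
Local Notation Ex f := (\int[P]_w (f w)).

(** Clamping the time to [0, Tmax] turns joint measurability on that domain
    into joint measurability everywhere. *)
Lemma measurable_clamped_process (c : R) : 0 <= Tmax ->
  measurable_fun [set: R * Omega]
    (fun q => X (Num.max 0 (Num.min (q.1 + c) Tmax)) q.2).
Proof.
move=> Tmax0.
pose g (q : R * Omega) := (Num.max 0 (Num.min (q.1 + c) Tmax), q.2).
have mg : measurable_fun [set: R * Omega] g.
  apply: measurable_fun_pair; last exact: measurable_snd.
  apply: measurable_maxr => //; apply: measurable_minr => //.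
  by apply: measurable_funD => //; exact: measurable_fst.
apply: (@measurable_comp _ _ _ _ _ _ (`[0, Tmax] `*` [set: Omega])
  (fun p : R * Omega => X p.1 p.2) [set: R * Omega] g) => //.
- by apply: measurableX => //; exact: measurable_itv.
- move=> _ [q _ <-]; split => //=; rewrite in_itv/= le_max lexx/=.
  by rewrite ge_max Tmax0 ge_min lexx orbT.
Qed.

Variables (e D : R).
Hypotheses (e_gt0 : 0 < e) (eT : e <= Tmax - T) (D_ge0 : 0 <= D)
  (delta2_le : forall s, s \in `[0, T] -> delta2 X s (s + e) <= D).

Let K : R := gauss_const m * 4 ^+ m * D ^+ m.-1.

Let inTmax s : s \in `[0, T] -> s \in `[0, Tmax].
Proof. by rewrite !in_itv/= => /andP[-> ?]/=; move: e_gt0 eT; lra. Qed.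

Let inTmaxe s : s \in `[0, T] -> s + e \in `[0, Tmax].
Proof. by rewrite !in_itv/= => /andP[? ?]; apply/andP; move: e_gt0 eT; split; lra. Qed.

Let theta s t := Ex (fun w => increment X s (s + e) w * increment X t (t + e) w).

Let theta_le s t : s \in `[0, T] -> t \in `[0, T] -> `|theta s t| <= D.
Proof.
move=> hs ht; apply: (increment_covariance_le X_gauss);
  by [exact: inTmax|exact: inTmaxe|exact: delta2_le].
Qed.

Let K_ge0 : 0 <= K.
Proof.
apply: mulr_ge0; last exact: exprn_ge0.
by apply: mulr_ge0; [exact: gauss_const_ge0|exact: exprn_ge0].
Qed.

Let moment_le s t : s \in `[0, T] -> t \in `[0, T] ->
  (`|\int[P]_w (increment X s (s + e) w ^+ m *
      increment X t (t + e) w ^+ m)%:E| <= (K * `|theta s t|)%:E)%E.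
Proof.
move=> hs ht.
have pr := increment_pair X_gauss (inTmax hs) (inTmaxe hs) (inTmax ht) (inTmaxe ht).
have mi := @gaussian_monomial_integrable _ _ _ P _ _
  (measurable_increment X s (s + e)) (measurable_increment X t (t + e)) pr
  m m m (addnn m).
rewrite -EFin_normr_Rintegral// lee_fin.
apply: (gaussian_odd_moment_le _ _ pr) => //;
  try exact: measurable_increment; last exact: theta_le.
- by have := delta2_le hs; rewrite delta2E.
- by have := delta2_le ht; rewrite delta2E.
Qed.

(** The dominating function: the first term is used on the strip, the second
    one off the strip. *)
Let Phi (p : R * R) : \bar R :=
  (K%:E * ((D * \1_(strip T e) p)%:E +
    (spos mu (xsection (window T e) p) + sneg mu (xsection (window T e) p))))%E.

Let Phi_sum_ge0 p : (0 <= (D * \1_(strip T e) p)%:E +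
    (spos mu (xsection (window T e) p) + sneg mu (xsection (window T e) p)))%E.
Proof.
rewrite adde_ge0//; first by rewrite lee_fin mulr_ge0.
by rewrite adde_ge0// measure_ge0.
Qed.

Hypothesis dmu : mixed_derivative_is (open_square Tmax `\` diagonal) (delta2 X) mu.
Hypothesis delta_o : forall eta : R, 0 < eta -> \forall r \near 0^'+,
  (delta_sup X T r <= (eta * r `^ (2 * m%:R)^-1)%:E)%E.

Let theta_Phi s t : s \in `[0, T] -> t \in `[0, T] ->
  ((K * `|theta s t|)%:E <= Phi (s, t))%E.
Proof.
move=> hs ht; rewrite EFinM /Phi; apply: lee_wpmul2l; first by rewrite lee_fin.
have [st|st] := pselect (strip T e (s, t)).
  rewrite indicE mem_set// mulr1 -[leLHS]adde0; apply: leeD.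
    by rewrite lee_fin theta_le.
  by rewrite adde_ge0// measure_ge0.
rewrite indicE memNset// mulr0 add0e.
have mono (p : R * R) (B : set (R * R)) : measurable B -> B `<=` xsection (window T e) p ->
    (abs_measure mu B <= spos mu (xsection (window T e) p) +
      sneg mu (xsection (window T e) p))%E.
  move=> mB sB; have mx : measurable (xsection (window T e) p).
    by apply: measurable_xsection; exact (measurable_window T e).
  by apply: leeD; apply: le_measure => //; rewrite inE.
have mE u v : measurable (enlarged_box e u v).
  by apply: measurableX; exact: measurable_itv.
have TTmax : T <= Tmax by move: e_gt0 eT; lra.
have [fst|fts] := notin_strip hs ht st.
- have [sub _] := far_window_sub e_gt0 fst.
  exact: le_trans (far_covariance_le TTmax X_gauss delta_o dmu e_gt0 eT fst) (mono _ _ (mE _ _) sub).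
- have [_ sub] := far_window_sub e_gt0 fts.
  have := far_covariance_le TTmax X_gauss delta_o dmu e_gt0 eT fts.
  under eq_Rintegral do rewrite mulrC.
  by move=> /le_trans; apply; exact: mono _ _ (mE _ _) sub.
Qed.

Let measurable_nu_xsection (nu : {sigma_finite_measure set (R * R)%type -> \bar R}) :
  measurable_fun [set: R * R] (fun p => nu (xsection (window T e) p)).
Proof. exact: (measurable_fun_xsection nu (measurable_window T e)). Qed.

Let measurable_Phi_sum : measurable_fun [set: R * R]
  (fun p => (D * \1_(strip T e) p)%:E +
    (spos mu (xsection (window T e) p) + sneg mu (xsection (window T e) p)))%E.
Proof.
apply: emeasurable_funD.
  apply/measurable_EFinP; apply: measurable_funM => //.
  by apply: measurable_indic; exact: measurable_strip.
by apply: emeasurable_funD; exact: measurable_nu_xsection.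
Qed.

Let measurable_Phi : measurable_fun [set: R * R] Phi.
Proof. exact: emeasurable_funM. Qed.

Lemma integral_Phi_le : (\int[leb2]_p Phi p <=
  K%:E * ((12 * T * e * D)%:E + (18 * e ^+ 2)%:E * abs_measure mu (OD T e)))%E.
Proof.
have mN : measurable_fun [set: measurableTypeR R * measurableTypeR R]
  (fun p : measurableTypeR R * measurableTypeR R => (\1_(strip T e) p)%:E : \bar R).
  have h : measurable_fun [set: R * R] (fun p : R * R => (\1_(strip T e) p)%:E : \bar R).
    by apply/measurable_EFinP; apply: measurable_indic; exact: measurable_strip.
  exact h.
rewrite ge0_integralZl_EFin//.
apply: lee_wpmul2l; first by rewrite lee_fin.
rewrite ge0_integralD//; last 4 first.
- by move=> p _; rewrite lee_fin mulr_ge0.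
- under eq_fun do rewrite EFinM; exact: emeasurable_funM.
- by move=> p _; rewrite adde_ge0// measure_ge0.
- have h : measurable_fun [set: R * R] (fun p => spos mu (xsection (window T e) p)
      + sneg mu (xsection (window T e) p))%E.
    by apply: emeasurable_funD; exact: measurable_nu_xsection.
  exact h.
apply: leeD.
  under eq_integral do rewrite EFinM.
  rewrite ge0_integralZl_EFin//.
  rewrite integral_indic//; last exact (measurable_strip T e).
  rewrite setIT [(12 * T * e * D)%R]mulrC EFinM.
  apply: lee_wpmul2l; first by rewrite lee_fin.
  exact: leb2_strip_le.
rewrite ge0_integralD//; last 2 first.
- exact (measurable_nu_xsection (spos mu)).
- exact (measurable_nu_xsection (sneg mu)).
rewrite /abs_measure ge0_muleDr ?measure_ge0//.
by apply: leeD; exact: integral_window_le.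
Qed.

Lemma odd_increment_second_moment_le :
  measurable_fun [set: Omega]
    (fun w => \int[leb]_(s in `[0, T]) (X (s + e) w - X s w) ^+ m) /\
  (\int[P]_w ((\int[leb]_(s in `[0%R, T]) (X (s + e) w - X s w) ^+ m)%R ^+ 2)%:E <=
  K%:E * ((12 * T * e * D)%:E + (18 * e ^+ 2)%:E * abs_measure mu (OD T e)))%E.
Proof.
have Tmax0 : 0 <= Tmax by move: T_gt0 e_gt0 eT; lra.
pose h (q : measurableTypeR R * Omega) : R :=
  (X (Num.max 0 (Num.min (q.1 + e) Tmax)) q.2 -
   X (Num.max 0 (Num.min (q.1 + 0) Tmax)) q.2) ^+ m.
have mh : measurable_fun [set: measurableTypeR R * Omega] h.
  have mh' : measurable_fun [set: R * Omega] (h : R * Omega -> R).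
    by apply: measurable_funX; apply: measurable_funB; exact: measurable_clamped_process.
  exact mh'.
have clampE s : s \in `[0, Tmax] -> Num.max 0 (Num.min s Tmax) = s.
  by rewrite in_itv/= => /andP[s0 sT]; rewrite (min_idPl sT) (max_idPr s0).
have hE s w : s \in `[0, T] -> h (s, w) = increment X s (s + e) w ^+ m.
  by move=> hs; rewrite /h/= addr0 (clampE _ (inTmax hs)) (clampE _ (inTmaxe hs)).
have IE w : \int[leb]_(s in `[0, T]) (X (s + e) w - X s w) ^+ m =
    \int[leb]_(s in `[0, T]) h (s, w).
  by apply: eq_Rintegral => s; rewrite inE => hs; rewrite hE.
have mD : @measurable _ (measurableTypeR R) `[0, T] by exact (measurable_itv _).
have Dfin : (leb `[0%R, T]%classic < +oo)%E.
  apply: (@le_lt_trans _ _ (T - 0)%:E); last by rewrite ltry.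
  by rewrite le_eqVlt; apply/orP; left; apply/eqP; exact: lebesgue_measure_cc (ltW T_gt0).
have hM s : `[0, T]%classic s ->
    (\int[P]_w (h (s, w) ^+ 2)%:E <= (gauss_const m * D ^+ m)%:E)%E.
  move=> hs.
  have [g E] := increment_pair X_gauss (inTmax hs) (inTmaxe hs) (inTmax hs) (inTmaxe hs) 1 0.
  have eY : (fun w => 1 * increment X s (s + e) w + 0 * increment X s (s + e) w) =
      increment X s (s + e).
    by apply/funext => w; rewrite mul1r mul0r addr0.
  rewrite eY in g E.
  have [iY eqY] := gaussian_even_moment m (measurable_increment X s (s + e)) g E.
  apply: (@le_trans _ _ (Ex (fun w => increment X s (s + e) w ^+ m.*2))%:E).
    rewrite /Rintegral fineK; last exact: integrable_fin_num iY.
    rewrite le_eqVlt; apply/orP; left; apply/eqP; apply: eq_integral => w _.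
    by rewrite hE// -exprM muln2.
  rewrite lee_fin eqY ler_wpM2l ?gauss_const_ge0// lerXn2r ?nnegrE//.
    by apply: Rintegral_ge0 => w _; exact: sqr_ge0.
  by rewrite -delta2E; exact: delta2_le.
have M0 : 0 <= gauss_const m * D ^+ m.
  by apply: mulr_ge0; [exact: gauss_const_ge0|exact: exprn_ge0].
have hPhi s t : `[0, T]%classic s -> `[0, T]%classic t ->
    (`|\int[P]_w (h (s, w) * h (t, w))%:E| <= Phi (s, t))%E.
  move=> hs ht; apply: le_trans (theta_Phi hs ht).
  apply: le_trans (moment_le hs ht).
  by under eq_integral do rewrite !hE//.
have mPhi : measurable_fun (`[0, T] `*` `[0, T])
    (Phi : measurableTypeR R * measurableTypeR R -> \bar R).
  have mPhi' : measurable_fun (`[0, T] `*` `[0, T]) Phi by exact: measurable_funTS.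
  exact mPhi'.
have [mI hI] := second_moment_integral_le mh mD Dfin M0 hM mPhi hPhi.
split; first by under eq_fun do rewrite IE.
under eq_integral do rewrite IE.
apply: (le_trans hI); apply: le_trans integral_Phi_le.
apply: (@ge0_subset_integral _ _ _ leb2 (`[0, T] `*` `[0, T]) setT) => //.
- by apply: measurableX.
- by move=> p _; rewrite /Phi mule_ge0 ?lee_fin//; exact: Phi_sum_ge0.
Qed.

End fixed_step.
(** * Conclusion *)

Lemma Lnorm2_le {R : realType} d (Omega : measurableType d)
    (P : probability Omega R) (f : Omega -> R) (y : R) : 0 <= y ->
  (\int[P]_w (f w ^+ 2)%:E <= (y ^+ 2)%:E)%E ->
  ('N[P]_(2%:E) [EFin \o f] <= y%:E)%E.
Proof.
move=> y0 hf; rewrite unlock /Lnorm.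
have -> : (\int[P]_w `|(EFin \o f) w| `^ 2 = \int[P]_w (f w ^+ 2)%:E)%E.
  apply: eq_integral => w _; rewrite /=; congr EFin.
  by rewrite powR_mulrn// real_normK ?num_real.
have -> : y%:E = ((y ^+ 2)%:E `^ 2^-1)%E.
  by rewrite poweR_EFin powR12_sqrt ?sqr_ge0// sqrtr_sqr ger0_norm.
have I0 : (0 <= \int[P]_w (f w ^+ 2)%:E)%E.
  by apply: integral_ge0 => w _; rewrite lee_fin sqr_ge0.
apply: gt0_ler_poweR => //; rewrite ?invr_ge0// in_itv/= leey andbT//.
by rewrite lee_fin sqr_ge0.
Qed.

Lemma powR_root_exprn {R : realType} (e : R) (m : nat) : 0 < e -> (0 < m)%N ->
  (e `^ (2 * m%:R)^-1) ^+ (2 * m) = e /\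
  e `^ (- ((m%:R - 1) / m%:R)) = ((e `^ (2 * m%:R)^-1) ^+ (2 * m.-1))^-1.
Proof.
move=> e0 m0; have mn0 : m%:R != 0 :> R by rewrite pnatr_eq0 -lt0n.
have E k : (e `^ (2 * m%:R)^-1) ^+ k = e `^ ((2 * m%:R)^-1 * k%:R).
  by rewrite -powR_mulrn ?powR_ge0// -powRrM.
split; rewrite E.
  by rewrite natrM mulVf ?powRr1 ?ltW// mulf_neq0.
rewrite -powRN; congr (_ `^ _); rewrite natrM -subn1 natrB//.
by field.
Qed.

(** With [q = e^(1/(2m))] one has [D = eta^2 q^2], [q^(2m) = e], and the power of
    [e] in the mass bound is [q^(-2(m-1))]: all powers of [e] cancel, leaving
    [12 T eta^(2m) + 18 c eta^(2(m-1))]. *)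
Lemma odd_variation_bound {R : realType} (e eta T c : R) (m : nat) :
  0 < e -> 0 < eta <= 1 -> 0 <= T -> (1 < m)%N ->
  let D := (eta * e `^ (2 * m%:R)^-1) ^+ 2 in
  e ^- 2 * (D ^+ m.-1 * (12 * T * e * D +
    18 * e ^+ 2 * (c * e `^ (- ((m%:R - 1) / m%:R))))) <=
  (12 * T + 18 * `|c|) * eta ^+ 2.
Proof.
move=> e0 /andP[eta0 eta1] T0 m1 /=.
have [] := powR_root_exprn e0 (ltnW m1).
move: (e `^ (- _)) (e `^ _) (powR_gt0 (2 * m%:R)^-1 e0) => x q q0 qE ->.
set D := (eta * q) ^+ 2.
have DE k : D ^+ k = eta ^+ (2 * k) * q ^+ (2 * k).
  by rewrite /D -exprM exprMn.
have DmE : D ^+ m.-1 * D = eta ^+ (2 * m) * e.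
  by rewrite -exprSr prednK ?(ltnW m1)// DE qE.
have -> : e ^- 2 * (D ^+ m.-1 * (12 * T * e * D +
    18 * e ^+ 2 * (c * (q ^+ (2 * m.-1))^-1))) =
    12 * T * (e^-1 * (D ^+ m.-1 * D)) + 18 * c * (D ^+ m.-1 * (q ^+ (2 * m.-1))^-1).
  by field; rewrite expf_neq0 ?gt_eqF.
have -> : D ^+ m.-1 * (q ^+ (2 * m.-1))^-1 = eta ^+ (2 * m.-1).
  by rewrite DE mulfK// expf_neq0// gt_eqF.
rewrite DmE.
have -> : e^-1 * (eta ^+ (2 * m) * e) = eta ^+ (2 * m) by field; rewrite gt_eqF.
have pw k : (0 < k)%N -> eta ^+ (2 * k) <= eta ^+ 2.
  case: k => // k _; rewrite mulnS exprD ler_piMr ?sqr_ge0//.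
  by rewrite exprn_ile1// ltW.
rewrite [leRHS]mulrDl; apply: lerD.
  by rewrite ler_wpM2l ?mulr_ge0// pw// ltnW.
apply: (@le_trans _ _ (18 * `|c| * eta ^+ (2 * m.-1))).
  apply: ler_wpM2r; first by rewrite exprn_ge0// ltW.
  by rewrite ler_wpM2l// ler_norm.
by rewrite ler_wpM2l ?mulr_ge0// pw// -subn1 subn_gt0.
Qed.

Theorem theorem8 (R : realType) (d : measure_display) (Omega : measurableType d)
    (P : probability Omega R) (T eps0 : R) (hT : 0 < T) (heps0 : 0 < eps0)
    (m : nat) (hm : (1 < m)%N) (m_odd : odd m)
    (W : R -> {RV P >-> R}) (hW : standard_brownian_motion (T + eps0) W)
    (G : R -> R -> R) (hG : wiener_kernel (T + eps0) G)
    (X : R -> {RV P >-> R})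
    (X_gauss : centered_gaussian_process (T + eps0) X)
    (X_meas : measurable_process (T + eps0) X)
    (X_repr : forall t, t \in `[0, T + eps0] ->
       is_wiener_integral P (T + eps0) W (G t) (X t))
    (delta_o : forall eta : R, 0 < eta -> \forall r \near 0^'+,
       (delta_sup X T r <= (eta * r `^ (2 * m%:R)^-1)%:E)%E)
    (mu : signed_measure (R * R)%type R)
    (mu_dom : abs_measure mu (~` (time_square (T + eps0) `\` diagonal)) = 0%E)
    (mu_deriv : mixed_derivative_is
       (open_square (T + eps0) `\` diagonal) (delta2 X) mu)
    (c : R)
    (mu_OD : \forall eps \near 0^'+,
       (abs_measure mu (OD T eps) <=
         (c * eps `^ (- ((m%:R - 1) / m%:R)))%:E)%E) :
  zero_odd_variation X T m.
Proof.
pose C : R := gauss_const m * 4 ^+ m * (12 * T + 18 * `|c|).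
have gc40 : 0 <= gauss_const m * 4 ^+ m :> R.
  by apply: mulr_ge0; [exact: gauss_const_ge0|exact: exprn_ge0].
have C0 : 0 <= C.
  by apply: mulr_ge0 => //; rewrite addr_ge0// mulr_ge0// ltW.
suff small kappa : 0 < kappa -> \forall eps \near 0^'+,
    (0 <= 'N[P]_(2%:E) [EFin \o odd_variation X T m eps] <= kappa%:E)%E.
  rewrite /zero_odd_variation; apply/fine_cvgP; split.
    apply: filterS (small 1 ltr01) => eps /andP[N0 N1].
    by rewrite ge0_fin_numE//; apply: le_lt_trans N1 (ltry _).
  apply/cvgrPdist_le => kappa kappa0; apply: filterS (small _ kappa0).
  move=> eps /andP[N0 N1] /=; rewrite sub0r normrN ger0_norm ?fine_ge0//.
  rewrite -lee_fin fineK// ge0_fin_numE//; exact: le_lt_trans N1 (ltry _).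
move=> kappa0.
pose eta := Num.min 1 (kappa / (Num.sqrt C + 1)).
have sC : 0 < Num.sqrt C + 1 by rewrite ltr_wpDl ?sqrtr_ge0.
have eta01 : 0 < eta <= 1.
  by rewrite lt_min ltr01 divr_gt0//= ge_min lexx.
have [eta0 eta1] := andP eta01.
(* eta is small enough for C eta^2 <= kappa^2; adding 1 to the square root
   keeps the quotient defined when C = 0 *)
have Ceta : C * eta ^+ 2 <= kappa ^+ 2.
  have h1 : eta * (Num.sqrt C + 1) <= kappa.
    by rewrite -ler_pdivlMr// ge_min lexx orbT.
  have h2 : Num.sqrt C * eta <= kappa.
    by apply: le_trans h1; rewrite mulrC ler_wpM2l ?ltW//; lra.
  rewrite -[C](sqr_sqrtr C0) -exprMn lerXn2r ?nnegrE ?(ltW kappa0)//.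
  by rewrite mulr_ge0 ?sqrtr_ge0// ltW.
have /near_at_right0[e1 e1_gt0 he1] := delta_o eta eta0.
have /near_at_right0[e2 e2_gt0 he2] := mu_OD.
apply/near_at_right0; exists (Num.min eps0 (Num.min e1 e2)).
  by rewrite !lt_min heps0 e1_gt0.
move=> e e_gt0; rewrite !lt_min => /and3P[e_eps0 ee1 ee2].
rewrite Lnorm_ge0/=; apply: Lnorm2_le; first exact: ltW.
pose D := (eta * e `^ (2 * m%:R)^-1) ^+ 2.
have y0 : 0 <= eta * e `^ (2 * m%:R)^-1 by rewrite mulr_ge0 ?powR_ge0// ltW.
have D0 : 0 <= D by exact: sqr_ge0.
have hD s : s \in `[0, T] -> delta2 X s (s + e) <= D.
  by move=> hs; exact: delta2_le_of_delta_sup y0 (he1 _ e_gt0 ee1) hs.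
have eTmax : e <= T + eps0 - T by rewrite addrC addKr ltW.
have [mI hI] := odd_increment_second_moment_le hT m_odd X_gauss X_meas e_gt0
  eTmax D0 hD mu_deriv delta_o.
under eq_integral do rewrite /odd_variation exprMn EFinM.
rewrite ge0_integralZl_EFin ?sqr_ge0//; last 2 first.
- by move=> w _; rewrite lee_fin sqr_ge0.
- by apply/measurable_EFinP; exact: measurable_funX.
rewrite exprVn; apply: (@le_trans _ _ ((e ^- 2)%:E *
  ((gauss_const m * 4 ^+ m * D ^+ m.-1)%:E * ((12 * T * e * D)%:E +
  (18 * e ^+ 2)%:E * (c * e `^ (- ((m%:R - 1) / m%:R)))%:E)))%E).
  apply: lee_wpmul2l; first by rewrite lee_fin invr_ge0 exprn_ge0// ltW.
  apply: (le_trans hI); apply: lee_wpmul2l.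
    by rewrite lee_fin mulr_ge0// exprn_ge0.
  rewrite leeD2l//; apply: lee_wpmul2l; last exact: he2.
  by rewrite lee_fin mulr_ge0// sqr_ge0.
rewrite -!EFinM lee_fin; apply: le_trans Ceta.
rewrite /C -[X in e ^- 2 * X]mulrA mulrCA -[leRHS]mulrA; apply: ler_wpM2l => //.
exact: odd_variation_bound (ltW hT) hm.
Qed.
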